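(* Let $\mathcal{M}$ be the global sections of a holonomic family over a reduced affine variety $B$ over $\mathbb{C}$ with finitely generated coordinate ring $\mathbb{C}[B]$. If a regular sequence $\mathbf{y}$ in $\mathbb{C}[B]$ generates the ideal of a $\mathbb{C}$-valued closed point $\beta\in B_{\mathbb{C}}$, then $\beta$ is rank-jumping if and only if the Koszul complex $K_\bullet(\mathbf{y};\mathcal{M}(x))$ has nonzero homology $H_i(\mathbf{y};\mathcal{M}(x))$ for some $i>0$.
   Context: $D$ is the Weyl algebra over $\mathbb{C}$ in $x=x_1,\dots,x_n$ and $\partial_1,\dots,\partial_n$. For a $\mathbb{C}[x]$-module (or sheaf of $\mathbb{C}[x]$-modules) $N$ put $N(x)=\mathbb{C}(x)\otimes_{\mathbb{C}[x]}N$. For a scheme $B$ over $\mathbb{C}$ put $B(x)=\operatorname{Spec}\mathbb{C}(x)\times_{\operatorname{Spec}\mathbb{C}}B$. For $\beta\in B$ let $\kappa_\beta$ be the residue field; $B_{\mathbb{C}}\subseteq B$ is the set of closed points with residue field $\mathbb{C}$. A $D$-module $N$ is holonomic if it is a finitely generated left $D$-module with $\operatorname{Ext}^j_D(N,D)=0$ for $j\neq n$; its holonomic rank is $\operatorname{rank}(N)=\dim_{\mathbb{C}(x)}N(x)$. A coherent sheaf of left $(D\otimes_{\mathbb{C}}\mathcal{O}_B)$-modules is one that is quasi-coherent over $\mathcal{O}_B$ and whose sections over each affine open $U\subseteq B$ are finitely generated over the ring of global sections of $D\otimes_{\mathbb{C}}\mathcal{O}_U$. A holonomic family over $B$ is a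 coherent sheaf $\tilde{\mathcal{M}}$ of left $(D\otimes_{\mathbb{C}}\mathcal{O}_B)$-modules whose fibers $\mathcal{M}_\beta=\tilde{\mathcal{M}}\otimes_{\mathcal{O}_B}\kappa_\beta$ are holonomic for all $\beta\in B$ (for $\kappa_\beta\neq\mathbb{C}$ this is understood over the Weyl algebra $D\otimes_{\mathbb{C}}\kappa_\beta$), and whose rank sheaf $\tilde{\mathcal{M}}(x)$ is coherent on the scheme $B(x)$. A point $\beta\in B$ is rank-jumping if (i) $\beta\in B_{\mathbb{C}}$, and (ii) for all open sets $U\subseteq B$ containing $\beta$, the rank of $\mathcal{M}_\beta$ is strictly greater than the minimal holonomic rank attained by any fiber $\mathcal{M}_{\beta'}$ with $\beta'\in U\cap B_{\mathbb{C}}$. A sequence $\mathbf{y}=y_1,\dots,y_d$ in a commutative ring $T$ is regular if $T/\langle\mathbf{y}\rangle\neq0$ and $y_i$ is a non-zerodivisor on $T/\langle y_1,\dots,y_{i-1}\rangle$ for $i=1,\dots,d$. For a $T$-module $N$, $K_\bullet(\mathbf{y};N)=K_\bullet(\mathbf{y})\otimes_TN$ is the Koszul complex, in homological degrees $d$ to $0$, and $H_i(\mathbf{y};N)$ is its $i$-th homology; here $T=\mathbb{C}[B]$. *)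

(* Defs.v *)
From HB Require Import structures.
From mathcomp Require Import all_boot all_order all_algebra.
From mathcomp Require Import generic_quotient ring_quotient fraction.
From mathcomp Require Import mpoly complex.
From mathcomp Require Import boolp reals.

Set Implicit Arguments.
Unset Strict Implicit.
Unset Printing Implicit Defensive.

Import GRing.Theory.
Local Open Scope ring_scope.
Local Open Scope quotient_scope.

Section RingPresentation.
Variable G : Type.

Inductive rexpr : Type :=
| RGen of G
| RZero
| ROne
| ROpp of rexpr
| RAdd of rexpr & rexpr
| RMul of rexpr & rexpr.

Variable rel : rexpr -> rexpr -> Prop.

(* The least ring congruence containing [rel]. *)
Inductive rcong : rexpr -> rexpr -> Prop :=
| rc_rel u v : rel u v -> rcong u v
| rc_refl u : rcong u u
| rc_sym u v : rcong u v -> rcong v u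
| rc_trans u v w : rcong u v -> rcong v w -> rcong u w
| rc_opp u u' : rcong u u' -> rcong (ROpp u) (ROpp u')
| rc_add u u' v v' : rcong u u' -> rcong v v' -> rcong (RAdd u v) (RAdd u' v')
| rc_mul u u' v v' : rcong u u' -> rcong v v' -> rcong (RMul u v) (RMul u' v')
| rc_addA u v w : rcong (RAdd u (RAdd v w)) (RAdd (RAdd u v) w)
| rc_addC u v : rcong (RAdd u v) (RAdd v u)
| rc_add0 u : rcong (RAdd RZero u) u
| rc_addN u : rcong (RAdd (ROpp u) u) RZero
| rc_mulA u v w : rcong (RMul u (RMul v w)) (RMul (RMul u v) w)
| rc_mul1l u : rcong (RMul ROne u) u
| rc_mul1r u : rcong (RMul u ROne) u
| rc_mulDl u v w : rcong (RMul (RAdd u v) w) (RAdd (RMul u w) (RMul v w))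
| rc_mulDr u v w : rcong (RMul u (RAdd v w)) (RAdd (RMul u v) (RMul u w)).

HB.instance Definition _ := gen_eqMixin rexpr.
HB.instance Definition _ := gen_choiceMixin rexpr.

Definition rcongb (u v : rexpr) : bool := `[< rcong u v >].

Lemma rcongb_equiv : equiv_class_of rcongb.
Proof.
split=> [u|u v|v u w].
- by apply/asboolP; apply: rc_refl.
- by apply/asboolP/asboolP; apply: rc_sym.
- by move=> /asboolP uv /asboolP vw; apply/asboolP; apply: rc_trans uv vw.
Qed.

Canonical rcongb_equivRel := EquivRelPack rcongb_equiv.

Definition pres_ring := {eq_quot rcongb}.
HB.instance Definition _ := Choice.on pres_ring.

Definition pres_cls (u : rexpr) : pres_ring := \pi_{eq_quot rcongb} u.
Definition pres_rep (a : pres_ring) : rexpr := @repr _ {eq_quot rcongb} a.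

Lemma pres_repK a : pres_cls (pres_rep a) = a.
Proof. exact: reprK. Qed.

Lemma pres_clsP u v : pres_cls u = pres_cls v <-> rcong u v.
Proof.
split=> [/eqmodP|uv]; first by move=> /asboolP.
by apply/eqmodP/asboolP.
Qed.

Lemma pres_rep_cls u : rcong (pres_rep (pres_cls u)) u.
Proof. by apply/pres_clsP; rewrite pres_repK. Qed.

Definition pres_zero := pres_cls RZero.
Definition pres_one := pres_cls ROne.
Definition pres_opp a := pres_cls (ROpp (pres_rep a)).
Definition pres_add a b := pres_cls (RAdd (pres_rep a) (pres_rep b)).
Definition pres_mul a b := pres_cls (RMul (pres_rep a) (pres_rep b)).

Lemma pres_oppE u : pres_opp (pres_cls u) = pres_cls (ROpp u).
Proof. by apply/pres_clsP/rc_opp/pres_rep_cls. Qed.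
Lemma pres_addE u v : pres_add (pres_cls u) (pres_cls v) = pres_cls (RAdd u v).
Proof. by apply/pres_clsP; apply: rc_add; apply: pres_rep_cls. Qed.
Lemma pres_mulE u v : pres_mul (pres_cls u) (pres_cls v) = pres_cls (RMul u v).
Proof. by apply/pres_clsP; apply: rc_mul; apply: pres_rep_cls. Qed.

Lemma pres_addA : associative pres_add.
Proof.
move=> a b c; rewrite -[a]pres_repK -[b]pres_repK -[c]pres_repK !pres_addE.
by apply/pres_clsP/rc_addA.
Qed.
Lemma pres_addC : commutative pres_add.
Proof.
move=> a b; rewrite -[a]pres_repK -[b]pres_repK !pres_addE.
by apply/pres_clsP/rc_addC.
Qed.
Lemma pres_add0 : left_id pres_zero pres_add.
Proof.
by move=> a; rewrite -[a]pres_repK pres_addE; apply/pres_clsP/rc_add0.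
Qed.
Lemma pres_addN : left_inverse pres_zero pres_opp pres_add.
Proof.
by move=> a; rewrite -[a]pres_repK pres_oppE pres_addE; apply/pres_clsP/rc_addN.
Qed.

HB.instance Definition _ :=
  GRing.isZmodule.Build pres_ring pres_addA pres_addC pres_add0 pres_addN.

Lemma pres_mulA : associative pres_mul.
Proof.
move=> a b c; rewrite -[a]pres_repK -[b]pres_repK -[c]pres_repK !pres_mulE.
by apply/pres_clsP/rc_mulA.
Qed.
Lemma pres_mul1l : left_id pres_one pres_mul.
Proof.
by move=> a; rewrite -[a]pres_repK pres_mulE; apply/pres_clsP/rc_mul1l.
Qed.
Lemma pres_mul1r : right_id pres_one pres_mul.
Proof.
by move=> a; rewrite -[a]pres_repK pres_mulE; apply/pres_clsP/rc_mul1r.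
Qed.
Lemma pres_mulDl : left_distributive pres_mul pres_add.
Proof.
move=> a b c; rewrite -[a]pres_repK -[b]pres_repK -[c]pres_repK.
by rewrite !(pres_mulE, pres_addE); apply/pres_clsP/rc_mulDl.
Qed.
Lemma pres_mulDr : right_distributive pres_mul pres_add.
Proof.
move=> a b c; rewrite -[a]pres_repK -[b]pres_repK -[c]pres_repK.
by rewrite !(pres_mulE, pres_addE); apply/pres_clsP/rc_mulDr.
Qed.

HB.instance Definition _ := GRing.Zmodule_isPzRing.Build pres_ring
  pres_mulA pres_mul1l pres_mul1r pres_mulDl pres_mulDr.

Definition pres_gen (g : G) : pres_ring := pres_cls (RGen g).

Lemma pres_clsZero : pres_cls RZero = 0. Proof. by []. Qed.
Lemma pres_clsOne : pres_cls ROne = 1. Proof. by []. Qed.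
Lemma pres_clsOpp u : pres_cls (ROpp u) = - pres_cls u.
Proof. exact: (esym (pres_oppE u)). Qed.
Lemma pres_clsAdd u v : pres_cls (RAdd u v) = pres_cls u + pres_cls v.
Proof. exact: (esym (pres_addE u v)). Qed.
Lemma pres_clsMul u v : pres_cls (RMul u v) = pres_cls u * pres_cls v.
Proof. exact: (esym (pres_mulE u v)). Qed.
Definition pres_clsE :=
  (pres_clsZero, pres_clsOne, pres_clsOpp, pres_clsAdd, pres_clsMul).

(* A left module over [pres_ring] is an abelian group on which the generators
   act by additive maps satisfying the relations. *)
Section Action.
Variables (V : zmodType) (rho : G -> V -> V).

Fixpoint reval (u : rexpr) : V -> V :=
  match u with
  | RGen g => rho g
  | RZero => fun=> 0
  | ROne => id
  | ROpp u => fun v => - reval u v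
  | RAdd u w => fun v => reval u v + reval w v
  | RMul u w => fun v => reval u (reval w v)
  end.

Hypothesis rhoD : forall g, {morph rho g : v w / v + w}.
Hypothesis rho_rel : forall u w, rel u w -> reval u =1 reval w.

Lemma revalD u : {morph reval u : v w / v + w}.
Proof.
elim: u => [g|||u IHu|u IHu w IHw|u IHu w IHw] v1 v2 //=.
- exact: rhoD.
- by rewrite addr0.
- by rewrite IHu opprD.
- by rewrite IHu IHw addrACA.
- by rewrite IHw IHu.
Qed.

Lemma reval0 u : reval u 0 = 0.
Proof. by apply: (addIr (reval u 0)); rewrite -revalD !add0r. Qed.

Lemma reval_cong u w : rcong u w -> reval u =1 reval w.
Proof.
elim=> {u w} //=.
- by move=> u w _ IH v; rewrite IH.
- by move=> u w z _ IH1 _ IH2 v; rewrite IH1 IH2.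
- by move=> u u' _ IH v; rewrite IH.
- by move=> u u' w w' _ IH1 _ IH2 v; rewrite IH1 IH2.
- by move=> u u' w w' _ IH1 _ IH2 v; rewrite IH2 IH1.
- by move=> u w z v; rewrite addrA.
- by move=> u w v; rewrite addrC.
- by move=> u v; rewrite add0r.
- by move=> u v; rewrite addNr.
- by move=> u w z v; rewrite revalD.
Qed.

Definition pres_act (a : pres_ring) (v : V) : V := reval (pres_rep a) v.

Lemma pres_actE u v : pres_act (pres_cls u) v = reval u v.
Proof. exact/reval_cong/pres_rep_cls. Qed.

Lemma pres_actA a b v : pres_act a (pres_act b v) = pres_act (a * b) v.
Proof.
rewrite -[a]pres_repK -[b]pres_repK.
by rewrite -pres_clsMul !pres_actE.
Qed.
Lemma pres_act1 : left_id 1 pres_act.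
Proof. by move=> v; rewrite pres_actE. Qed.
Lemma pres_actDr : right_distributive pres_act +%R.
Proof. by move=> a v w; rewrite -[a]pres_repK !pres_actE revalD. Qed.
Lemma pres_actDl v : {morph pres_act^~ v : a b / a + b}.
Proof.
move=> a b; rewrite -[a]pres_repK -[b]pres_repK.
by rewrite -pres_clsAdd !pres_actE.
Qed.
End Action.

End RingPresentation.

Section Weyl.
Variables (K : fieldType) (n : nat).

Inductive weyl_gen : Type :=
| WConst of K
| WX of 'I_n
| WD of 'I_n.

Local Notation "u *r v" := (RMul u v) (at level 40).
Local Notation "u +r v" := (RAdd u v) (at level 50).
Local Notation cst c := (RGen (WConst c)).
Local Notation X i := (RGen (WX i)).
Local Notation D i := (RGen (WD i)).

Inductive weyl_rel : rexpr weyl_gen -> rexpr weyl_gen -> Prop :=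
| weyl_const1 : weyl_rel (cst 1) (ROne _)
| weyl_constD a b : weyl_rel (cst (a + b)) (cst a +r cst b)
| weyl_constM a b : weyl_rel (cst (a * b)) (cst a *r cst b)
| weyl_constX a i : weyl_rel (cst a *r X i) (X i *r cst a)
| weyl_constd a i : weyl_rel (cst a *r D i) (D i *r cst a)
| weyl_XX i j : weyl_rel (X i *r X j) (X j *r X i)
| weyl_DD i j : weyl_rel (D i *r D j) (D j *r D i)
| weyl_DX i j : weyl_rel (D i *r X j) (X j *r D i +r cst (i == j)%:R).

(* K<x_1..x_n, d_1..d_n> / ([x_i,x_j], [d_i,d_j], [d_i,x_j] - delta_ij) *)
Definition weyl := pres_ring weyl_rel.
HB.instance Definition _ := GRing.PzRing.on weyl.

Definition wconst (c : K) : weyl := pres_gen _ (WConst c).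
Definition wX (i : 'I_n) : weyl := pres_gen _ (WX i).
Definition wD (i : 'I_n) : weyl := pres_gen _ (WD i).

Definition weyl_poly (g : weyl_gen) (p : {mpoly K[n]}) : {mpoly K[n]} :=
  match g with
  | WConst c => c *: p
  | WX i => 'X_i * p
  | WD i => p^`M(i)
  end.

Lemma weyl_polyD g : {morph weyl_poly g : p q / p + q}.
Proof.
by case: g => [c|i|i] p q /=; rewrite ?scalerDr ?mulrDr ?mderivD.
Qed.

Lemma weyl_poly_rel u w : weyl_rel u w -> reval weyl_poly u =1 reval weyl_poly w.
Proof.
case.
- by move=> p /=; rewrite scale1r.
- by move=> a b p /=; rewrite scalerDl.
- by move=> a b p /=; rewrite scalerA.
- by move=> a i p /=; rewrite scalerAr.
- by move=> a i p /=; rewrite mderivZ.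
- by move=> i j p /=; rewrite mulrCA.
- by move=> i j p /=; rewrite mderiv_comm.
- move=> i j p /=; rewrite mderivM addrC; congr (_ + _).
  rewrite mderivX mnm1E eq_sym; case: eqP => [->|_]; last by rewrite !scale0r mul0r.
  have -> : (U_(j) - U_(j))%MM = 0%MM by apply/mnmP => k; rewrite mnmBE subnn mnm0E.
  by rewrite mpolyX0 !scale1r mul1r.
Qed.

Lemma weyl_nontrivial : (1 : weyl) != 0.
Proof.
apply/eqP => /(congr1 (fun a => pres_act weyl_poly a 1)).
rewrite -pres_clsOne -pres_clsZero !(pres_actE weyl_polyD weyl_poly_rel) /=.
by move/eqP; rewrite oner_eq0.
Qed.

HB.instance Definition _ :=
  GRing.PzSemiRing_isNonZero.Build weyl weyl_nontrivial.

Lemma wconst_is_zmod_morphism : zmod_morphism wconst.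
Proof.
suff wconstD : {morph wconst : a b / a + b}.
  by move=> a b; apply: (addIr (wconst b)); rewrite -wconstD !addrNK.
move=> a b; rewrite /wconst /pres_gen -pres_clsAdd.
exact/pres_clsP/rc_rel/weyl_constD.
Qed.

Lemma wconst_is_monoid_morphism : monoid_morphism wconst.
Proof.
split; first exact/pres_clsP/rc_rel/weyl_const1.
move=> a b; rewrite /wconst /pres_gen -pres_clsMul.
exact/pres_clsP/rc_rel/weyl_constM.
Qed.

HB.instance Definition _ :=
  GRing.isZmodMorphism.Build K weyl wconst wconst_is_zmod_morphism.
HB.instance Definition _ :=
  GRing.isMonoidMorphism.Build K weyl wconst wconst_is_monoid_morphism.

Lemma wXX i j : wX i * wX j = wX j * wX i.
Proof.
by rewrite /wX /pres_gen -!pres_clsMul; apply/pres_clsP/rc_rel/weyl_XX.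
Qed.
Lemma wconstX a i : wconst a * wX i = wX i * wconst a.
Proof.
rewrite /wX /wconst /pres_gen -!pres_clsMul.
exact/pres_clsP/rc_rel/weyl_constX.
Qed.

Definition poly_weyl (p : {mpoly K[n]}) : weyl := mmap wconst wX p.

Lemma poly_weyl_is_zmod_morphism : zmod_morphism poly_weyl.
Proof. by move=> p q; rewrite /poly_weyl mmapB. Qed.
HB.instance Definition _ := GRing.isZmodMorphism.Build {mpoly K[n]} weyl poly_weyl
  poly_weyl_is_zmod_morphism.

Lemma wX_mmap1 (m1 m2 : 'X_{1..n}) :
  mmap1 wX (m1 + m2) = mmap1 wX m1 * mmap1 wX m2.
Proof.
rewrite /mmap1 -prodrM_comm => [|i j _ _].
  by apply: eq_bigr => i _; rewrite mnmDE exprD.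
by apply: commrX; apply: commr_sym; apply: commrX; apply: wXX.
Qed.

Lemma wconst_mmap1 c (m : 'X_{1..n}) :
  GRing.comm (wconst c) (mmap1 wX m).
Proof.
by apply: commr_prod => i _; apply: commrX; apply: wconstX.
Qed.

Lemma poly_weyl_is_monoid_morphism : monoid_morphism poly_weyl.
Proof.
split; first by rewrite /poly_weyl -mpolyC1 mmapC; apply: (rmorph1 wconst).
move=> p q; rewrite (mpolyE p) mulr_suml !raddf_sum mulr_suml.
apply: eq_bigr => m _; rewrite (mpolyE q) mulr_sumr !raddf_sum mulr_sumr.
apply: eq_bigr => m' _; rewrite -scalerAl -scalerAr scalerA -mpolyXD.
rewrite /= /poly_weyl !mmapZ !mmapX wX_mmap1 rmorphM -!mulrA; congr (_ * _).
by rewrite !mulrA wconst_mmap1.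
Qed.

HB.instance Definition _ := GRing.isMonoidMorphism.Build {mpoly K[n]} weyl poly_weyl
  poly_weyl_is_monoid_morphism.

Lemma poly_weylC c : poly_weyl c%:MP = wconst c.
Proof. by rewrite /poly_weyl mmapC. Qed.

End Weyl.

Section TensorAlgebra.
Variables (K E S : pzRingType).
Variables (f : {rmorphism K -> E}) (h : {rmorphism K -> S}).

Inductive tens_gen : Type :=
| TL of E
| TR of S.

Local Notation "u *r v" := (RMul u v) (at level 40).
Local Notation "u +r v" := (RAdd u v) (at level 50).
Local Notation l e := (RGen (TL e)).
Local Notation r s := (RGen (TR s)).

Inductive tens_rel : rexpr tens_gen -> rexpr tens_gen -> Prop :=
| tens_l1 : tens_rel (l 1) (ROne _)
| tens_lD a b : tens_rel (l (a + b)) (l a +r l b)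
| tens_lM a b : tens_rel (l (a * b)) (l a *r l b)
| tens_r1 : tens_rel (r 1) (ROne _)
| tens_rD a b : tens_rel (r (a + b)) (r a +r r b)
| tens_rM a b : tens_rel (r (a * b)) (r a *r r b)
| tens_lr a b : tens_rel (l a *r r b) (r b *r l a)
| tens_base k : tens_rel (l (f k)) (r (h k)).

(* E (x)_K S for K-algebras E and S with structure maps f and h (whose images
   are meant to be central), presented by the elements l e = e (x) 1 and
   r s = 1 (x) s. *)
Definition tensalg := pres_ring tens_rel.
HB.instance Definition _ := GRing.PzRing.on tensalg.

Definition tensl (e : E) : tensalg := pres_gen _ (TL e).
Definition tensr (s : S) : tensalg := pres_gen _ (TR s).

Lemma tensl_is_zmod_morphism : zmod_morphism tensl.
Proof.
suff tenslD : {morph tensl : a b / a + b}.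
  by move=> a b; apply: (addIr (tensl b)); rewrite -tenslD !addrNK.
move=> a b; rewrite /tensl /pres_gen -pres_clsAdd.
exact/pres_clsP/rc_rel/tens_lD.
Qed.
Lemma tensl_is_monoid_morphism : monoid_morphism tensl.
Proof.
split; first exact/pres_clsP/rc_rel/tens_l1.
move=> a b; rewrite /tensl /pres_gen -pres_clsMul.
exact/pres_clsP/rc_rel/tens_lM.
Qed.
HB.instance Definition _ :=
  GRing.isZmodMorphism.Build E tensalg tensl tensl_is_zmod_morphism.
HB.instance Definition _ :=
  GRing.isMonoidMorphism.Build E tensalg tensl tensl_is_monoid_morphism.

Lemma tensr_is_zmod_morphism : zmod_morphism tensr.
Proof.
suff tensrD : {morph tensr : a b / a + b}.
  by move=> a b; apply: (addIr (tensr b)); rewrite -tensrD !addrNK.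
move=> a b; rewrite /tensr /pres_gen -pres_clsAdd.
exact/pres_clsP/rc_rel/tens_rD.
Qed.
Lemma tensr_is_monoid_morphism : monoid_morphism tensr.
Proof.
split; first exact/pres_clsP/rc_rel/tens_r1.
move=> a b; rewrite /tensr /pres_gen -pres_clsMul.
exact/pres_clsP/rc_rel/tens_rM.
Qed.
HB.instance Definition _ :=
  GRing.isZmodMorphism.Build S tensalg tensr tensr_is_zmod_morphism.
HB.instance Definition _ :=
  GRing.isMonoidMorphism.Build S tensalg tensr tensr_is_monoid_morphism.

Lemma tenslr_comm e s : GRing.comm (tensl e) (tensr s).
Proof.
rewrite /GRing.comm /tensl /tensr /pres_gen -!pres_clsMul.
exact/pres_clsP/rc_rel/tens_lr.
Qed.
Lemma tensl_base k : tensl (f k) = tensr (h k).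
Proof. exact/pres_clsP/rc_rel/tens_base. Qed.

End TensorAlgebra.

Section RestrictScalars.
Variables (T R : pzRingType) (f : {rmorphism T -> R}) (N : lmodType R).

Definition restr : Type := let _ := f in N.
HB.instance Definition _ := GRing.Zmodule.on restr.

Definition restr_scale (t : T) (v : restr) : restr := f t *: (v : N).

Lemma restr_scaleA a b v : restr_scale a (restr_scale b v) = restr_scale (a * b) v.
Proof. by rewrite /restr_scale scalerA rmorphM. Qed.
Lemma restr_scale1 : left_id 1 restr_scale.
Proof. by move=> v; rewrite /restr_scale rmorph1 scale1r. Qed.
Lemma restr_scaleDr : right_distributive restr_scale +%R.
Proof. by move=> a v w; rewrite /restr_scale scalerDr. Qed.
Lemma restr_scaleDl v : {morph restr_scale^~ v : a b / a + b}.
Proof. by move=> a b; rewrite /restr_scale rmorphD scalerDl. Qed.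

HB.instance Definition _ := GRing.Zmodule_isLmodule.Build T restr
  restr_scaleA restr_scale1 restr_scaleDr restr_scaleDl.

End RestrictScalars.

Section ExtendScalars.
Variables (T S : pzRingType) (g : {rmorphism T -> S}) (N : lmodType T).

Inductive texpr : Type :=
| TPure of S & N
| TZero
| TOpp of texpr
| TAdd of texpr & texpr.

Inductive tcong : texpr -> texpr -> Prop :=
| tc_pureDl s s' m : tcong (TPure (s + s') m) (TAdd (TPure s m) (TPure s' m))
| tc_pureDr s m m' : tcong (TPure s (m + m')) (TAdd (TPure s m) (TPure s m'))
| tc_pureZ s t m : tcong (TPure (s * g t) m) (TPure s (t *: m))
| tc_refl u : tcong u u
| tc_sym u v : tcong u v -> tcong v u
| tc_trans u v w : tcong u v -> tcong v w -> tcong u w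
| tc_opp u u' : tcong u u' -> tcong (TOpp u) (TOpp u')
| tc_add u u' v v' : tcong u u' -> tcong v v' -> tcong (TAdd u v) (TAdd u' v')
| tc_addA u v w : tcong (TAdd u (TAdd v w)) (TAdd (TAdd u v) w)
| tc_addC u v : tcong (TAdd u v) (TAdd v u)
| tc_add0 u : tcong (TAdd TZero u) u
| tc_addN u : tcong (TAdd (TOpp u) u) TZero.

HB.instance Definition _ := gen_eqMixin texpr.
HB.instance Definition _ := gen_choiceMixin texpr.

Definition tcongb (u v : texpr) : bool := `[< tcong u v >].

Lemma tcongb_equiv : equiv_class_of tcongb.
Proof.
split=> [u|u v|v u w].
- by apply/asboolP; apply: tc_refl.
- by apply/asboolP/asboolP; apply: tc_sym.
- by move=> /asboolP uv /asboolP vw; apply/asboolP; apply: tc_trans uv vw.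
Qed.

Canonical tcongb_equivRel := EquivRelPack tcongb_equiv.

(* S (x)_T N, the quotient of the free abelian group on the pure tensors by
   the bilinearity and balancing relations. *)
Definition tensor := {eq_quot tcongb}.
HB.instance Definition _ := Choice.on tensor.

Definition tensor_cls (u : texpr) : tensor := \pi_{eq_quot tcongb} u.
Definition tensor_rep (a : tensor) : texpr := @repr _ {eq_quot tcongb} a.

Lemma tensor_repK a : tensor_cls (tensor_rep a) = a.
Proof. exact: reprK. Qed.

Lemma tensor_clsP u v : tensor_cls u = tensor_cls v <-> tcong u v.
Proof.
split=> [/eqmodP|uv]; first by move=> /asboolP.
by apply/eqmodP/asboolP.
Qed.

Lemma tensor_rep_cls u : tcong (tensor_rep (tensor_cls u)) u.
Proof. by apply/tensor_clsP; rewrite tensor_repK. Qed.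

Definition tensor_zero := tensor_cls TZero.
Definition tensor_opp a := tensor_cls (TOpp (tensor_rep a)).
Definition tensor_add a b := tensor_cls (TAdd (tensor_rep a) (tensor_rep b)).

Lemma tensor_oppE u : tensor_opp (tensor_cls u) = tensor_cls (TOpp u).
Proof. by apply/tensor_clsP/tc_opp/tensor_rep_cls. Qed.
Lemma tensor_addE u v :
  tensor_add (tensor_cls u) (tensor_cls v) = tensor_cls (TAdd u v).
Proof. by apply/tensor_clsP; apply: tc_add; apply: tensor_rep_cls. Qed.

Lemma tensor_addA : associative tensor_add.
Proof.
move=> a b c; rewrite -[a]tensor_repK -[b]tensor_repK -[c]tensor_repK.
by rewrite !tensor_addE; apply/tensor_clsP/tc_addA.
Qed.
Lemma tensor_addC : commutative tensor_add.
Proof.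
move=> a b; rewrite -[a]tensor_repK -[b]tensor_repK !tensor_addE.
by apply/tensor_clsP/tc_addC.
Qed.
Lemma tensor_add0 : left_id tensor_zero tensor_add.
Proof.
by move=> a; rewrite -[a]tensor_repK tensor_addE; apply/tensor_clsP/tc_add0.
Qed.
Lemma tensor_addN : left_inverse tensor_zero tensor_opp tensor_add.
Proof.
move=> a; rewrite -[a]tensor_repK tensor_oppE tensor_addE.
exact/tensor_clsP/tc_addN.
Qed.

HB.instance Definition _ := GRing.isZmodule.Build tensor
  tensor_addA tensor_addC tensor_add0 tensor_addN.

Definition pure (s : S) (m : N) : tensor := tensor_cls (TPure s m).

Lemma tensor_clsZero : tensor_cls TZero = 0. Proof. by []. Qed.
Lemma tensor_clsOpp u : tensor_cls (TOpp u) = - tensor_cls u.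
Proof. exact: (esym (tensor_oppE u)). Qed.
Lemma tensor_clsAdd u v : tensor_cls (TAdd u v) = tensor_cls u + tensor_cls v.
Proof. exact: (esym (tensor_addE u v)). Qed.

Lemma pureDl s s' m : pure (s + s') m = pure s m + pure s' m.
Proof. by rewrite -tensor_clsAdd; apply/tensor_clsP/tc_pureDl. Qed.
Lemma pureDr s m m' : pure s (m + m') = pure s m + pure s m'.
Proof. by rewrite -tensor_clsAdd; apply/tensor_clsP/tc_pureDr. Qed.
Lemma pureZ s t m : pure (s * g t) m = pure s (t *: m).
Proof. exact/tensor_clsP/tc_pureZ. Qed.

Lemma tensor_ind (P : tensor -> Prop) :
    (forall s m, P (pure s m)) -> P 0 -> (forall a, P a -> P (- a)) ->
    (forall a b, P a -> P b -> P (a + b)) ->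
  forall a, P a.
Proof.
move=> Ppure P0 PN PD a; rewrite -[a]tensor_repK.
elim: (tensor_rep a) => [s m||u IHu|u IHu v IHv]; first exact: Ppure.
- by rewrite tensor_clsZero.
- by rewrite tensor_clsOpp; apply: PN.
- by rewrite tensor_clsAdd; apply: PD.
Qed.

(* Additive maps out of the tensor product are balanced biadditive maps. *)
Section Lift.
Variables (V : zmodType) (phi : S -> N -> V).
Hypothesis phiDl : forall s s' m, phi (s + s') m = phi s m + phi s' m.
Hypothesis phiDr : forall s m m', phi s (m + m') = phi s m + phi s m'.
Hypothesis phiZ : forall s t m, phi (s * g t) m = phi s (t *: m).

Fixpoint teval (u : texpr) : V :=
  match u with
  | TPure s m => phi s m
  | TZero => 0
  | TOpp u => - teval u
  | TAdd u v => teval u + teval v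
  end.

Definition tensor_lift (a : tensor) : V := teval (tensor_rep a).

Lemma teval_cong u v : tcong u v -> teval u = teval v.
Proof.
elim=> {u v} //=.
- by move=> u v w _ -> _ ->.
- by move=> u u' _ ->.
- by move=> u u' v v' _ -> _ ->.
- by move=> u v w; rewrite addrA.
- by move=> u v; rewrite addrC.
- by move=> u; rewrite add0r.
- by move=> u; rewrite addNr.
Qed.

Lemma tensor_lift_cls u : tensor_lift (tensor_cls u) = teval u.
Proof. exact/teval_cong/tensor_rep_cls. Qed.

Lemma tensor_lift_pure s m : tensor_lift (pure s m) = phi s m.
Proof. exact: tensor_lift_cls. Qed.

Lemma tensor_liftD : {morph tensor_lift : a b / a + b}.
Proof.
move=> a b; rewrite -[a]tensor_repK -[b]tensor_repK -tensor_clsAdd.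
by rewrite !tensor_lift_cls.
Qed.
Lemma tensor_liftN : {morph tensor_lift : a / - a}.
Proof.
by move=> a; rewrite -[a]tensor_repK -tensor_clsOpp !tensor_lift_cls.
Qed.
Lemma tensor_lift0 : tensor_lift 0 = 0.
Proof. by rewrite -tensor_clsZero tensor_lift_cls. Qed.
End Lift.

Lemma tensor_additive_eq (V : zmodType) (F F' : tensor -> V) :
    {morph F : a b / a + b} -> {morph F' : a b / a + b} ->
    (forall s m, F (pure s m) = F' (pure s m)) -> F =1 F'.
Proof.
move=> FD F'D FF'.
have F0 : F 0 = 0 by apply: (addIr (F 0)); rewrite -FD !add0r.
have F'0 : F' 0 = 0 by apply: (addIr (F' 0)); rewrite -F'D !add0r.
elim/tensor_ind=> //; first by rewrite F0 F'0.
- by move=> a Fa; apply: (addIr (F a)); rewrite -FD [in RHS]Fa -F'D !addNr F0 F'0.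
- by move=> a b Fa Fb; rewrite FD F'D Fa Fb.
Qed.

Definition tensor_scale (s : S) : tensor -> tensor :=
  tensor_lift (fun s' m => pure (s * s') m).

Lemma tensor_scale_pure s s' m : tensor_scale s (pure s' m) = pure (s * s') m.
Proof.
apply: tensor_lift_pure.
- by move=> s1 s2 m1; rewrite mulrDr pureDl.
- by move=> s1 m1 m2; rewrite pureDr.
- by move=> s1 t m1; rewrite mulrA pureZ.
Qed.

Lemma tensor_scaleDr : right_distributive tensor_scale +%R.
Proof.
move=> s; apply: tensor_liftD.
- by move=> s1 s2 m1; rewrite mulrDr pureDl.
- by move=> s1 m1 m2; rewrite pureDr.
- by move=> s1 t m1; rewrite mulrA pureZ.
Qed.

Lemma tensor_scaleA s s' a :
  tensor_scale s (tensor_scale s' a) = tensor_scale (s * s') a.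
Proof.
move: a; apply: tensor_additive_eq => [a b|a b|s1 m].
- by rewrite !tensor_scaleDr.
- by rewrite !tensor_scaleDr.
- by rewrite !tensor_scale_pure mulrA.
Qed.

Lemma tensor_scale1 : left_id 1 tensor_scale.
Proof.
apply: tensor_additive_eq => [a b|a b|s1 m] //; first by rewrite tensor_scaleDr.
by rewrite tensor_scale_pure mul1r.
Qed.

Lemma tensor_scaleDl a : {morph tensor_scale^~ a : s s' / s + s'}.
Proof.
move=> s s'; move: a; apply: tensor_additive_eq => [a b|a b|s1 m].
- by rewrite !tensor_scaleDr.
- by rewrite !tensor_scaleDr addrACA.
- by rewrite !tensor_scale_pure mulrDl pureDl.
Qed.

HB.instance Definition _ := GRing.Zmodule_isLmodule.Build S tensor
  tensor_scaleA tensor_scale1 tensor_scaleDr tensor_scaleDl.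

End ExtendScalars.

(* Let M be a module over R, on which K-algebras E and T act through commuting
   maps u and v to R.  Then S (x)_T M is a module over E (x)_K S:
   (e (x) s) (s' (x) m) = s s' (x) e m. *)
Section BaseChange.
Variables (K E T R : pzRingType) (S : comPzRingType).
Variables (f : {rmorphism K -> E}) (h : {rmorphism K -> T}).
Variables (g : {rmorphism T -> S}).
Variables (u : {rmorphism E -> R}) (v : {rmorphism T -> R}).
Hypothesis uv_comm : forall e t, GRing.comm (u e) (v t).
Hypothesis uv_base : forall k, u (f k) = v (h k).
Variable M : lmodType R.

Definition base_change : Type :=
  let _ := uv_comm in let _ := uv_base in tensor g (restr v M).
HB.instance Definition _ := GRing.Zmodule.on base_change.

Local Notation MT := (tensor g (restr v M)).

Definition bc_left (e : E) : MT -> MT :=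
  tensor_lift (fun s (m : restr v M) => pure g s (u e *: (m : M) : restr v M)).

Lemma bc_left_aux1 e s s' (m : restr v M) :
  pure g (s + s') (u e *: (m : M) : restr v M) =
  pure g s (u e *: (m : M) : restr v M) + pure g s' (u e *: (m : M) : restr v M).
Proof. exact: pureDl. Qed.
Lemma bc_left_aux2 e s (m m' : restr v M) :
  pure g s (u e *: (m + m' : M) : restr v M) =
  pure g s (u e *: (m : M) : restr v M) + pure g s (u e *: (m' : M) : restr v M).
Proof. by rewrite scalerDr; apply: pureDr. Qed.
Lemma bc_left_aux3 e s t (m : restr v M) :
  pure g (s * g t) (u e *: (m : M) : restr v M) =
  pure g s (u e *: (t *: m : M) : restr v M).
Proof.
rewrite pureZ; congr pure.
change (v t *: (u e *: (m : M)) = u e *: (v t *: (m : M))).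
by rewrite !scalerA uv_comm.
Qed.

Lemma bc_leftD e : {morph bc_left e : a b / a + b}.
Proof.
exact: (tensor_liftD (@bc_left_aux1 e) (@bc_left_aux2 e) (@bc_left_aux3 e)).
Qed.
Lemma bc_left_pure e s (m : restr v M) :
  bc_left e (pure g s m) = pure g s (u e *: (m : M) : restr v M).
Proof.
exact: (tensor_lift_pure (@bc_left_aux1 e) (@bc_left_aux2 e) (@bc_left_aux3 e)).
Qed.

Definition bc_gen (x : tens_gen E S) : MT -> MT :=
  match x with
  | TL e => bc_left e
  | TR s => fun a => s *: a
  end.

Lemma bc_genD x : {morph bc_gen x : a b / a + b}.
Proof. by case: x => [e|s] a b /=; rewrite ?bc_leftD ?scalerDr. Qed.

Lemma bc_gen_rel a b :
  tens_rel f (g \o h) a b -> reval bc_gen a =1 reval bc_gen b.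
Proof.
have ext (F F' : MT -> MT) (x : MT) :
    {morph F : a b / a + b} -> {morph F' : a b / a + b} ->
    (forall s m, F (pure g s m) = F' (pure g s m)) -> F x = F' x.
  by move=> FD F'D FF'; apply: tensor_additive_eq.
case=> [|e e'|e e'||s s'|s s'|e s|k] x /=.
- apply: ext => [||s m] //; first exact: bc_leftD.
  by rewrite bc_left_pure rmorph1 scale1r.
- apply: (ext _ (fun x => bc_left e x + bc_left e' x)) => [|a' b'|s m].
  + exact: bc_leftD.
  + by rewrite !bc_leftD addrACA.
  + by rewrite !bc_left_pure rmorphD scalerDl; apply: pureDr.
- apply: (ext _ (fun x => bc_left e (bc_left e' x))) => [|a' b'|s m].
  + exact: bc_leftD.
  + by rewrite !bc_leftD.
  + by rewrite !bc_left_pure rmorphM scalerA.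
- exact: scale1r.
- exact: scalerDl.
- by rewrite scalerA.
- apply: (ext (fun x => bc_left e (s *: x)) (fun x => s *: bc_left e x)).
  + by move=> a' b'; rewrite scalerDr bc_leftD.
  + by move=> a' b'; rewrite bc_leftD scalerDr.
  + move=> s' m; rewrite bc_left_pure.
    change (bc_left e (tensor_scale s (pure g s' m)) =
      tensor_scale s (pure g s' (u e *: (m : M) : restr v M))).
    by rewrite !tensor_scale_pure bc_left_pure.
- apply: (ext _ (fun x => g (h k) *: x)).
  + exact: bc_leftD.
  + by move=> a' b'; rewrite scalerDr.
  + move=> s m; rewrite bc_left_pure uv_base.
    change (pure g s (h k *: m) = tensor_scale (g (h k)) (pure g s m)).
    by rewrite -pureZ tensor_scale_pure mulrC.
Qed.

HB.instance Definition _ :=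
  GRing.Zmodule_isLmodule.Build (tensalg f (g \o h)) base_change
    (pres_actA bc_genD bc_gen_rel) (pres_act1 bc_genD bc_gen_rel)
    (pres_actDr bc_genD bc_gen_rel) (pres_actDl bc_genD bc_gen_rel).

End BaseChange.

Section Modules.
Variable W : pzRingType.
Implicit Types N P L : lmodType W.

Definition finitely_generated N : Prop :=
  exists (k : nat) (m : 'I_k -> N),
    forall v, exists a : 'I_k -> W, v = \sum_(i < k) a i *: m i.

Definition has_basis_of_size N (r : nat) : Prop :=
  exists b : 'I_r -> N,
    forall v, exists! a : {ffun 'I_r -> W}, v = \sum_(i < r) a i *: b i.

Definition projective P : Prop :=
  forall (X Y : lmodType W) (q : {linear X -> Y}) (f : {linear P -> Y}),
    (forall y, exists x, q x = y) ->
  exists g : {linear P -> X}, forall p, q (g p) = f p.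

Record projective_resolution N : Type := {
  pr_mod : nat -> lmodType W;
  pr_diff : forall i, {linear pr_mod i.+1 -> pr_mod i};
  pr_aug : {linear pr_mod 0%N -> N};
  pr_projective : forall i, projective (pr_mod i);
  pr_exactN : forall v, exists x, pr_aug x = v;
  pr_exact0 : forall x, pr_aug x = 0 <-> exists y, pr_diff 0%N y = x;
  pr_exactS : forall i x, pr_diff i x = 0 <-> exists y, pr_diff i.+1 y = x }.

Definition hom_cocycle N (P : projective_resolution N) L (j : nat)
    (f : {linear pr_mod P j -> L}) : Prop :=
  forall x, f (pr_diff P j x) = 0.

Definition hom_coboundary N (P : projective_resolution N) L (j : nat) :
    {linear pr_mod P j -> L} -> Prop :=
  match j with
  | 0 => fun f => forall x, f x = 0
  | i.+1 => fun f =>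
      exists g : {linear pr_mod P i -> L}, forall x, f x = g (pr_diff P i x)
  end.

(* Ext^j_W(N, L) = 0; it does not matter which resolution computes it. *)
Definition Ext_vanishes N L (j : nat) : Prop :=
  forall P : projective_resolution N,
    forall f : {linear pr_mod P j -> L}, hom_cocycle f -> hom_coboundary f.

Definition holonomic (n : nat) N : Prop :=
  finitely_generated N /\ forall j : nat, j <> n -> Ext_vanishes N W^o j.

End Modules.

Section Koszul.
Variables (T : comPzRingType) (d : nat).
Implicit Type y : 'I_d -> T.

Definition in_span y (P : pred 'I_d) (a : T) : Prop :=
  exists c : 'I_d -> T, a = \sum_(i < d | P i) c i * y i.

Definition regular_sequence y : Prop :=
  ~ in_span y predT 1 /\
  forall i : 'I_d, let before := [pred j : 'I_d | (j < i)%N] in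
    forall a, in_span y before (y i * a) -> in_span y before a.

(* A chain of K(y; N) is written \sum_J w_J e_J, with e_J the wedge of the
   e_j, j in J, in increasing order. *)
Definition koszul_chain (N : lmodType T) : Type := {ffun {set 'I_d} -> N}.

Definition koszul_deg (N : lmodType T) (i : nat) (w : koszul_chain N) : Prop :=
  forall J : {set 'I_d}, #|J| <> i -> w J = 0.

(* d(e_J) = \sum_(k in J) (-1)^#{j in J | j < k} y_k e_(J \ k), read off
   coefficientwise. *)
Definition koszul_diff y (N : lmodType T) (w : koszul_chain N) :
    koszul_chain N :=
  [ffun J : {set 'I_d} => \sum_(k < d | k \notin J)
     ((-1) ^+ #|[set j in J | (j < k)%N]| * y k) *: w (k |: J)].

Definition koszul_homology_neq0 y (N : lmodType T) (i : nat) : Prop :=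
  exists w : koszul_chain N,
    [/\ koszul_deg i w, koszul_diff y w = 0 &
        forall w' : koszul_chain N, koszul_deg i.+1 w' -> koszul_diff y w' <> w].

End Koszul.

(* The points of Spec A are the elements of the library type [prime_idealr A]
   of (boolean, hence by classical logic arbitrary) prime ideals. *)

Section Residue.
Variables (A : comNzRingType) (p : prime_idealr A).

Definition prime_quot : Type := {ideal_quot p}.
HB.instance Definition _ := GRing.ComNzRing.on prime_quot.

Definition pq_unit : pred prime_quot :=
  fun x => `[< exists y : prime_quot, y * x = 1 >].
Definition pq_inv (x : prime_quot) : prime_quot :=
  if pselect (exists y : prime_quot, y * x = 1) is left e
  then projT1 (cid e) else x.

Lemma pq_mulVx : {in pq_unit, left_inverse 1 pq_inv *%R}.
Proof.
move=> x /asboolP xu; rewrite /pq_inv; case: pselect => // e.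
exact: projT2 (cid e).
Qed.
Lemma pq_unitPl (x y : prime_quot) : y * x = 1 -> pq_unit x.
Proof. by move=> yx; apply/asboolP; exists y. Qed.
Lemma pq_invr_out : {in [predC pq_unit], pq_inv =1 id}.
Proof.
move=> x /negP xu; rewrite /pq_inv; case: pselect => // e.
by case: xu; apply/asboolP.
Qed.

HB.instance Definition _ := GRing.ComNzRing_hasMulInverse.Build prime_quot
  pq_mulVx pq_unitPl pq_invr_out.

Lemma pq_integral : GRing.integral_domain_axiom prime_quot.
Proof. exact: Quotient.rquot_IdomainAxiom. Qed.

HB.instance Definition _ :=
  GRing.ComUnitRing_isIntegral.Build prime_quot pq_integral.

Definition residue_field : fieldType := {fraction prime_quot}.

Definition pq_pi (a : A) : prime_quot := \pi_{ideal_quot p} a.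
Lemma pq_pi_is_zmod_morphism : zmod_morphism pq_pi.
Proof. exact: (raddfB (\pi_{ideal_quot p})). Qed.
Lemma pq_pi_is_monoid_morphism : monoid_morphism pq_pi.
Proof.
by split; [apply: (rmorph1 (\pi_{ideal_quot p}))
          |apply: (rmorphM (\pi_{ideal_quot p}))].
Qed.
HB.instance Definition _ :=
  GRing.isZmodMorphism.Build A prime_quot pq_pi pq_pi_is_zmod_morphism.
HB.instance Definition _ :=
  GRing.isMonoidMorphism.Build A prime_quot pq_pi pq_pi_is_monoid_morphism.

Definition residue_map : {rmorphism A -> residue_field} :=
  @tofrac prime_quot \o pq_pi.

End Residue.

Section AffineScheme.
Variables (K : fieldType) (A : comAlgType K).

Definition zariski_open (U : prime_idealr A -> Prop) : Prop :=
  exists I : A -> Prop,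
    forall q : prime_idealr A, U q <-> exists2 a : A, I a & ~~ (q a).

Definition closed_point (p : prime_idealr A) : Prop :=
  zariski_open (fun q : prime_idealr A => ~ (q =1 p)).

Definition rational_point (p : prime_idealr A) : Prop :=
  closed_point p /\ bijective (fun c : K => residue_map p c%:A).

Definition finitely_generated_algebra : Prop :=
  exists (m : nat) (x : 'I_m -> A),
    forall a : A, exists P : {mpoly K[m]}, a = mmap (in_alg A) x P.

Definition reduced : Prop := forall (a : A) (k : nat), a ^+ k = 0 -> a = 0.

End AffineScheme.

Section Family.
Variables (K : fieldType) (n : nat) (A : comAlgType K).

Definition ratfun : fieldType := {fraction {mpoly K[n]}}.

Definition poly_ratfun : {rmorphism {mpoly K[n]} -> ratfun} :=
  @tofrac {mpoly K[n]}.

(* rank N = r, for a module N over the Weyl algebra *)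
Definition rank_eq (N : lmodType (weyl K n)) (r : nat) : Prop :=
  has_basis_of_size (tensor poly_ratfun (restr (@poly_weyl K n) N)) r.

(* D (x)_K A *)
Definition weylA := tensalg (@wconst K n) (in_alg A).

(* D (x)_K kappa_p *)
Definition weyl_res (p : prime_idealr A) :=
  tensalg (@wconst K n) (residue_map p \o in_alg A).

(* The coordinate ring A (x)_K K(x) of B(x), for B = Spec A. *)
Definition coord_ratfun :=
  tensalg (in_alg A) (poly_ratfun \o @mpolyC n K).

Variable M : lmodType weylA.

Lemma weylA_comm (P : weyl K n) (a : A) :
  GRing.comm (tensl (@wconst K n) (in_alg A) P) (tensr (@wconst K n) (in_alg A) a).
Proof. exact: tenslr_comm. Qed.

(* kappa_p (x)_A M *)
Definition fiber (p : prime_idealr A) : lmodType (weyl_res p) :=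
  base_change (residue_map p) (@weylA_comm) (@tensl_base _ _ _ _ _) M.

Definition poly_weylA : {rmorphism {mpoly K[n]} -> weylA} :=
  tensl (@wconst K n) (in_alg A) \o @poly_weyl K n.

Lemma poly_weylA_comm (a : A) (q : {mpoly K[n]}) :
  GRing.comm (tensr (@wconst K n) (in_alg A) a) (poly_weylA q).
Proof. by apply: commr_sym; apply: tenslr_comm. Qed.

Lemma poly_weylA_base (c : K) :
  tensr (@wconst K n) (in_alg A) (in_alg A c) = poly_weylA (@mpolyC n K c).
Proof. by rewrite -tensl_base /poly_weylA /= poly_weylC. Qed.

(* M(x) = K(x) (x)_K[x] M *)
Definition rank_module : lmodType coord_ratfun :=
  base_change poly_ratfun poly_weylA_comm poly_weylA_base M.

Definition rank_moduleA : lmodType A :=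
  restr (tensl (in_alg A) (poly_ratfun \o @mpolyC n K)) rank_module.

(* On the affine scheme Spec A a quasi-coherent sheaf is the same thing as its
   module M of global sections, and coherence of the sheaves M~ and M~(x) means
   finite generation of M and M(x). *)
Definition holonomic_family : Prop :=
  [/\ finitely_generated M,
      forall p : prime_idealr A, holonomic n (fiber p) &
      finitely_generated rank_module].

(* For a K-rational point p, D (x)_K kappa_p is just D. *)
Definition fiber_rank_eq (p : prime_idealr A) (r : nat) : Prop :=
  rank_eq
    (restr (tensl (@wconst K n) (residue_map p \o in_alg A)) (fiber p)) r.

Definition minimal_rank (U : prime_idealr A -> Prop) (r : nat) : Prop :=
  (exists q, [/\ U q, rational_point q & fiber_rank_eq q r]) /\
  (forall q s, U q -> rational_point q -> fiber_rank_eq q s -> (r <= s)%N).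

Definition rank_jumping (p : prime_idealr A) : Prop :=
  rational_point p /\
  exists2 r : nat, fiber_rank_eq p r &
    forall U : prime_idealr A -> Prop, zariski_open U -> U p ->
      exists2 r0 : nat, minimal_rank U r0 & (r0 < r)%N.

End Family.

(* Main.v *)
Require Import Defs.
From HB Require Import structures.
From mathcomp Require Import all_boot all_order all_algebra.
From mathcomp Require Import ring_quotient complex reals.
From mathcomp Require Import fraction generic_quotient mpoly boolp.
From mathcomp Require classical_sets.

(** Put K for the ground field, B for the coordinate ring, T = B[x] and
    N = M(x).  The nonzero elements of K[x] act bijectively on N, and up to such
    denominators N is a finitely generated T-module.  A rational point of B is
    a K-algebra map eps : B -> K; it induces ev eps : T -> K[x], and the fibre
    at eps, of dimension the holonomic rank there, is the quotient of N by the
    kernel of eps, a vector space over K(x) ([to_fibre_model]).  So the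
    statement is about how the fibre dimensions of N vary, that is, about
    flatness of N along the point beta.

    Let g_1, ..., g_r lift a basis of the fibre at beta.  By Nakayama's lemma
    they generate N after inverting some s in T with s(beta) nonzero
    ([spans_spread]), so all ranks near beta are at most r, and beta is
    rank-jumping unless the g_i stay independent in all fibres near beta.
    Let Q be the module of relations among the g_i.

    If the Koszul homology vanishes in degree 1, a relation, whose coefficients
    vanish at beta, is a combination of the y_j with coefficients again in Q;
    hence Q = yQ near beta.  As T is Noetherian, Q is finitely generated, and
    Nakayama's lemma provides t with t(beta) nonzero and tQ = 0.  Where t does
    not vanish the g_i are therefore independent and the rank cannot drop
    ([indep_spread]).

    Conversely, if the rank is nowhere below r near beta, the g_i are bases of
    the fibres there, so the coefficients of a relation vanish at all rational
    points near beta.  Since B is reduced, the Nullstellensatz shows that some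
    sigma in T with sigma(beta) nonzero kills Q.  Up to sigma, N is then free.
    The Koszul complex of the regular sequence y on a free module is acyclic in
    positive degrees ([regular_koszul_acyclic]), and because y annihilates the
    Koszul homology ([koszul_homotopy]), sigma acts on it as an invertible
    scalar of K(x).  So the homology of N vanishes as well
    ([koszul_vanishing]). *)

Set Implicit Arguments.
Unset Strict Implicit.
Unset Printing Implicit Defensive.

Import GRing.Theory.
Local Open Scope ring_scope.

(** * Noetherian modules and Hilbert's basis theorem *)

Section Submodules.
Variables (R : pzRingType) (V : lmodType R).
Implicit Types (P : V -> Prop) (gs : seq V).

Definition submodule P : Prop :=
  P 0 /\ forall (a : R) (u v : V), P u -> P v -> P (a *: u + v).

(** Impredicative, so that a property is proved for the whole span by checking
    that it defines a submodule; [spanP] recovers the coefficients. *)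
Definition span gs (v : V) : Prop :=
  forall P, submodule P -> (forall g, g \in gs -> P g) -> P v.

Definition fin_gen P : Prop :=
  exists gs, (forall g, g \in gs -> P g) /\ forall v, P v -> span gs v.

Definition noetherian_mod : Prop := forall P, submodule P -> fin_gen P.

Lemma submodD P u v : submodule P -> P u -> P v -> P (u + v).
Proof. by case=> _ PD Pu Pv; rewrite -[u]scale1r; apply: PD. Qed.

Lemma submodZ P a u : submodule P -> P u -> P (a *: u).
Proof. by case=> P0 PD Pu; rewrite -[_ *: _]addr0; apply: PD. Qed.

Lemma submodB P u v : submodule P -> P u -> P v -> P (u - v).
Proof. by move=> sP Pu Pv; rewrite -scaleN1r; apply: submodD => //; apply: submodZ. Qed.

Lemma submod_sum P (I : finType) (F : I -> V) (p : pred I) :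
  submodule P -> (forall i, p i -> P (F i)) -> P (\sum_(i | p i) F i).
Proof.
move=> sP PF; apply: (big_ind P) => //; first by case: sP.
by move=> u v; apply: submodD.
Qed.

Lemma span_submod gs : submodule (span gs).
Proof.
split=> [P [P0 _] _|a u v su sv P sP gP] //.
by apply: (sP.2); [apply: su | apply: sv].
Qed.

Lemma mem_span gs g : g \in gs -> span gs g.
Proof. by move=> gg P _; apply. Qed.

Lemma span_sub gs gs' v : {subset gs <= gs'} -> span gs v -> span gs' v.
Proof. by move=> ss sv P sP gP; apply: sv => // g /ss; apply: gP. Qed.

Lemma spanP gs v :
  span gs v -> exists c : nat -> R, v = \sum_(i < size gs) c i *: gs`_i.
Proof.
move=> sv; apply: (sv (fun v => exists c : nat -> R, v = \sum_(i < size gs) c i *: gs`_i)).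
  split=> [|a u w [c ->] [c' ->]].
    by exists (fun=> 0); rewrite big1 // => i _; rewrite scale0r.
  exists (fun i => a * c i + c' i); rewrite scaler_sumr -big_split /=.
  by apply: eq_bigr => i _; rewrite scalerDl scalerA.
move=> g gg; have lt_g : (index g gs < size gs)%N by rewrite index_mem.
exists (fun i => (i == index g gs)%:R).
rewrite (bigD1 (Ordinal lt_g)) //= eqxx scale1r nth_index // big1 ?addr0 // => i.
by rewrite -val_eqE /= => /negPf ->; rewrite scale0r.
Qed.

End Submodules.

(** The ring changes together with the module so that this also covers quotient
    rings. *)
Lemma noetherian_image (R S : pzRingType) (V : lmodType R) (W : lmodType S)
    (phi : R -> S) (f : V -> W) :
    (forall b, exists a, phi a = b) -> (forall w, exists v, f v = w) ->
    {morph f : u v / u + v} -> (forall a v, f (a *: v) = phi a *: f v) ->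
  noetherian_mod V -> noetherian_mod W.
Proof.
move=> phi_surj f_surj fD fZ noeV P sP.
have f0 : f 0 = 0 by apply: (addIr (f 0)); rewrite -fD !add0r.
have [] := noeV (fun v => P (f v)).
  split=> [|a u v Pu Pv]; first by rewrite f0; case: sP.
  by rewrite fD fZ; apply: sP.2.
move=> gs [gP spangs]; exists (map f gs); split=> [_ /mapP [g gg ->]|w Pw].
  exact: gP.
have [v fv] := f_surj w; rewrite -fv in Pw *.
apply: (spangs _ Pw (fun v => span (map f gs) (f v))) => [|g gg].
  split=> [|a u u' su su']; first by rewrite f0; case: (span_submod (map f gs)).
  by rewrite fD fZ; apply: (span_submod _).2.
by apply: mem_span; apply: map_f.
Qed.

(** A submodule of an extension is generated by lifts of generators of its image
    together with generators of its intersection with the kernel. *)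
Lemma noetherian_ext (R : pzRingType) (V W : lmodType R) (f : V -> W) :
    {morph f : u v / u + v} -> (forall a v, f (a *: v) = a *: f v) ->
    (forall P : V -> Prop, submodule P -> (forall v, P v -> f v = 0) -> fin_gen P) ->
  noetherian_mod W -> noetherian_mod V.
Proof.
move=> fD fZ noeK noeW P sP.
have f0 : f 0 = 0 by apply: (addIr (f 0)); rewrite -fD !add0r.
have [|hs [hP spanh]] := noeW (fun w => exists2 v, P v & f v = w).
  split=> [|a _ _ [u Pu <-] [v Pv <-]]; first by exists 0 => //; case: sP.
  by exists (a *: u + v); [apply: sP.2 | rewrite fD fZ].
have [|//|ks [kP spank]] := noeK (fun v => P v /\ f v = 0); last 1 first.
- have /choice [l lP] (h : W) :
      exists v, h \in hs -> P v /\ f v = h.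
    by case: (boolP (h \in hs)) => [/hP [v Pv fv]|_]; [exists v | exists 0].
  exists (map l hs ++ ks); split=> [g|v Pv].
    rewrite mem_cat => /orP [/mapP [h hh ->]|/kP [] //].
    by case: (lP h hh).
  have [u su fu] : exists2 u, span (map l hs ++ ks) u /\ P u & f u = f v.
    have : exists2 u, P u & f u = f v by exists v.
    move/spanh => /(_ (fun w => exists2 u, span (map l hs ++ ks) u /\ P u & f u = w)).
    apply=> [|h hh].
      split=> [|a _ _ [u [su Pu] <-] [u' [su' Pu'] <-]].
        exists 0 => //; split; last by case: sP.
        by case: (span_submod (map l hs ++ ks)).
      exists (a *: u + u'); last by rewrite fD fZ.
      by split; [apply: (span_submod _).2 | apply: sP.2].
    exists (l h); last by case: (lP h hh).
    split; last by case: (lP h hh).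
    by apply: mem_span; rewrite mem_cat map_f.
  case: su => su Pu; rewrite -[v](subrK u) -[v - u]scale1r.
  apply: (span_submod _).2 => //.
  have : P (v - u) /\ f (v - u) = 0.
    split; first exact: submodB.
    by rewrite -scaleN1r fD fZ fu scaleN1r subrr.
  move/spank; apply: span_sub => g gg; by rewrite mem_cat gg orbT.
- split=> [|a u v [Pu fu] [Pv fv]]; first by split; [case: sP|].
  by split; [apply: sP.2 | rewrite fD fZ fu fv scaler0 addr0].
by move=> v [].
Qed.

(** Induction on the rank: the first coordinate is a linear form whose kernel is
    free of rank one less. *)
Lemma noetherian_free (R : pzRingType) (r : nat) :
  noetherian_mod R^o -> noetherian_mod {ffun 'I_r -> R^o}.
Proof.
move=> noeR; elim: r => [|r IHr].
  move=> P sP; exists [::]; split=> // v _.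
  suff -> : v = 0 by case: (@span_submod _ {ffun 'I_0 -> R^o} [::]).
  by apply/ffunP => - [].
pose f (v : {ffun 'I_r.+1 -> R^o}) : R^o := v ord0.
have fD : {morph f : u v / u + v} by move=> u v; rewrite /f ffunE.
have fZ a v : f (a *: v) = a *: f v by rewrite /f ffunE.
apply: (noetherian_ext fD fZ) => // P sP P0.
pose cons0 (w : {ffun 'I_r -> R^o}) : {ffun 'I_r.+1 -> R^o} :=
  [ffun i => if unlift ord0 i is Some j then w j else 0].
have cons0D a u v : cons0 (a *: u + v) = a *: cons0 u + cons0 v.
  apply/ffunP => i; rewrite !ffunE.
  by case: unliftP => [j _|_]; rewrite ?ffunE ?scaler0 ?addr0.
have cons00 : cons0 0 = 0.
  by apply/ffunP => i; rewrite !ffunE; case: unliftP => [j _|_]; rewrite ?ffunE.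
have [|gs [gP spang]] := IHr (fun w => P (cons0 w)).
  split=> [|a u v Pu Pv]; last by rewrite cons0D; apply: sP.2.
  by rewrite cons00; case: sP.
exists (map cons0 gs); split=> [_ /mapP [g gg ->]|v Pv]; first exact: gP.
have vE : v = cons0 [ffun j => v (lift ord0 j)].
  apply/ffunP => i; rewrite !ffunE; case: unliftP => [j ->|->]; rewrite ?ffunE //.
  exact: P0.
rewrite vE in Pv *; apply: (spang _ Pv (fun w => span (map cons0 gs) (cons0 w))).
  split=> [|a u u' su su']; last by rewrite cons0D; apply: (span_submod _).2.
  by rewrite cons00; case: (span_submod (map cons0 gs)).
by move=> g gg; apply: mem_span; apply: map_f.
Qed.

Lemma noetherian_field (F : fieldType) : noetherian_mod F^o.
Proof.
move=> P sP; have [[a Pa a0]|nP] := pselect (exists2 a : F, P a & a != 0).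
  exists [:: a]; split=> [g|v _]; first by rewrite inE => /eqP ->.
  have -> : v = (v / a : F) *: (a : F^o) by rewrite /GRing.scale /= divfK.
  by apply: (submodZ _ (span_submod _)); apply: mem_span; rewrite inE.
exists [::]; split=> // v Pv; have -> : v = 0.
  by apply/eqP/negPn/negP => v0; apply: nP; exists v.
by case: (@span_submod _ F^o [::]).
Qed.

(** Hilbert's basis theorem.  The leading coefficients of an ideal I form an
    ideal, generated by those of finitely many f in I.  If all these f have
    size at most N, they reduce every element of I to one of size at
    most N, and the elements of I of size at most N form a submodule of the
    free module of rank N. *)
Theorem hilbert_basis (R : comNzRingType) :
  noetherian_mod R^o -> noetherian_mod ({poly R})^o.
Proof.
move=> noeR I sI.
have IM (p q : {poly R}) : I q -> I (p * q) by move=> Iq; apply: (submodZ p sI Iq).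
have ID (p q : {poly R}) : I p -> I q -> I (p + q) := @submodD _ _ I p q sI.
have IZ a (q : {poly R}) : I q -> I (a *: q).
  by move=> Iq; rewrite -mul_polyC; apply: IM.
have I0 : I 0 by case: sI.
pose LC (a : R) : Prop := exists (f : {poly R}) (k : nat),
  [/\ I f, (size f <= k.+1)%N & f`_k = a].
have [|as_ [asP span_as]] := noeR LC.
  split=> [|a u v [f [k [If sf <-]]] [g [l [Ig sg <-]]]].
    by exists 0, 0%N; split; rewrite ?size_poly0 ?coef0.
  exists (a *: f * 'X^l + g * 'X^k), (k + l)%N; split.
  - by apply: ID; rewrite mulrC; apply: IM => //; apply: IZ.
  - rewrite (leq_trans (size_polyD _ _)) // geq_max.
    apply/andP; split; apply: leq_trans (size_polyMleq _ _) _; rewrite size_polyXn addnS /=.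
      by rewrite -addSn leq_add2r (leq_trans (size_scale_leq _ _)).
    by rewrite addnC -addnS leq_add2l.
  - by rewrite coefD !coefMXn ltnNge leq_addl ltnNge leq_addr /= addnK addKn coefZ.
have /choice [F FP] (a : R) : exists fk : {poly R} * nat, a \in as_ ->
    [/\ I fk.1, (size fk.1 <= fk.2.+1)%N & fk.1`_fk.2 = a].
  case: (boolP (a \in as_)) => [/asP [f [k H]]|_]; first by exists (f, k).
  by exists (0, 0%N).
(* all chosen generators have size at most N *)
pose N := \max_(a <- as_) (F a).2.+1.
have leN a : a \in as_ -> ((F a).2 < N)%N.
  by move=> aa; rewrite /N; apply: (@leq_bigmax_seq _ as_ xpredT (fun a => (F a).2.+1)).
have noeN : noetherian_mod {ffun 'I_N -> R^o} by apply: noetherian_free.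
pose poly_of (w : {ffun 'I_N -> R^o}) : {poly R} :=
  \poly_(i < N) (if insub i is Some j then w j else 0).
have poly_ofE w i : (poly_of w)`_i = if insub i is Some j then w j else 0.
  by rewrite coef_poly; case: insubP => [j -> //|/negPf ->].
have poly_ofL a u v : poly_of (a *: u + v) = a *: poly_of u + poly_of v.
  apply/polyP => i; rewrite coefD coefZ !poly_ofE.
  by case: insubP => [j _ _|_]; rewrite ?mulr0 ?addr0 // !ffunE.
have poly_of0 : poly_of 0 = 0.
  by apply/polyP => i; rewrite poly_ofE coef0; case: insubP => // j; rewrite ffunE.
have [|gs [gP span_gs]] := noeN (fun w => I (poly_of w)).
  split=> [|a u v Iu Iv]; first by rewrite poly_of0.
  by rewrite poly_ofL; apply: ID => //; apply: IZ.
pose hs : seq ({poly R})^o := map (fun a => (F a).1) as_ ++ map poly_of gs.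
pose sp := @span {poly R} ({poly R})^o hs.
have sH : @submodule {poly R} ({poly R})^o sp by exact: span_submod.
exists hs; split=> [h|p].
  rewrite mem_cat => /orP [/mapP [a aa ->]|/mapP [g gg ->]]; last exact: gP.
  by case: (FP a aa).
have [k le_pk] := ubnP (size p); elim: k => // k IHk in p le_pk *.
move=> Ip; have [le_pN|lt_Np] := leqP (size p) N.
  have pE : p = poly_of [ffun j : 'I_N => p`_j].
    apply/polyP => i; rewrite poly_ofE; case: insubP => [j _ <-|]; first by rewrite ffunE.
    by rewrite -leqNgt => le_Ni; rewrite nth_default // (leq_trans le_pN).
  rewrite pE in Ip *.
  apply: (span_gs _ Ip (fun w => sp (poly_of w))).
    split=> [|a u v su sv]; first by rewrite poly_of0; case: sH.
    by rewrite poly_ofL -mul_polyC; apply: sH.2.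
  by move=> g gg; apply: mem_span; rewrite mem_cat map_f ?orbT.
have p_gt0 : (0 < size p)%N by apply: leq_ltn_trans lt_Np.
have /span_as /spanP [c lcE] : LC (lead_coef p).
  by exists p, (size p).-1; split; rewrite // prednK.
have p0 : p != 0 by rewrite -size_poly_gt0.
(* an element of I with the leading term of p *)
pose q := \sum_(i < size as_)
  ((c i)%:P * 'X^((size p).-1 - (F as_`_i).2)) * (F as_`_i).1.
have sq : sp q.
  apply: (submod_sum sH) => i _; apply: (submodZ _ sH); apply: mem_span.
  rewrite mem_cat; apply/orP; left; apply: (map_f (fun a => (F a).1)).
  exact: mem_nth.
have Iq : I q.
  apply: (submod_sum sI) => i _; apply: (submodZ _ sI).
  by have [] := FP _ (mem_nth 0 (ltn_ord i)).
have coefq : q`_(size p).-1 = lead_coef p.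
  rewrite lcE coef_sum; apply: eq_bigr => i _.
  have ai := mem_nth 0 (ltn_ord i); have [_ _ Fi] := FP _ ai.
  rewrite -mulrA coefCM coefXnM ltnNge leq_subr /=.
  rewrite subKn ?Fi // -ltnS prednK //.
  exact: ltn_trans (leN _ ai) lt_Np.
have sizeq : (size q <= size p)%N.
  apply: (leq_trans (size_sum _ _ _)); apply/bigmax_leqP => i _.
  have ai := mem_nth 0 (ltn_ord i); have [_ sFi _] := FP _ ai.
  rewrite -mulrA mul_polyC (leq_trans (size_scale_leq _ _)) //.
  rewrite (leq_trans (size_polyMleq _ _)) // size_polyXn addSn /=.
  rewrite (leq_trans (leq_add (leqnn _) sFi)) // addnS.
  have lt_Fp := ltn_trans (leN _ ai) lt_Np.
  by rewrite subnK ?prednK // -ltnS prednK.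
rewrite -[p](subrK q); apply: (submodD sH) sq.
apply: IHk; last by rewrite -scaleN1r; apply: ID => //; apply: IZ.
rewrite -ltnS; apply: leq_trans le_pk; rewrite ltnS.
have le_pq : (size (p - q)%R <= size p)%N.
  by rewrite (leq_trans (size_polyD _ _)) // size_polyN geq_max leqnn.
rewrite ltn_neqAle le_pq andbT; apply/eqP => eq_s.
have : lead_coef (p - q) = 0 by rewrite lead_coefE eq_s coefB coefq subrr.
move/eqP; rewrite lead_coef_eq0 => /eqP pq0.
by move: p_gt0; rewrite -eq_s pq0 size_poly0.
Qed.

Lemma noetherian_ring_image (R S : comNzRingType) (f : {rmorphism R -> S}) :
  (forall b, exists a, f a = b) -> noetherian_mod R^o -> noetherian_mod S^o.
Proof.
move=> f_surj; apply: (@noetherian_image R S R^o S^o f f) => //.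
  exact: rmorphD.
exact: rmorphM.
Qed.

(** R[x_1, ..., x_(n+1)] is the image of R[x_1, ..., x_n][X], with X sent to the
    last variable. *)
Lemma noetherian_mpoly (R : comNzRingType) (n : nat) :
  noetherian_mod R^o -> noetherian_mod ({mpoly R[n]})^o.
Proof.
move=> noeR; elim: n => [|n IHn].
  apply: (noetherian_ring_image (f := @mpolyC 0 R)) noeR => p.
  exists p@_0%MM; apply/mpolyP => m; rewrite mcoeffC.
  have -> : m = 0%MM by apply/mnmP => - [].
  by rewrite eqxx mulr1.
pose w (i : 'I_n) : {mpoly R[n.+1]} := 'X_(widen_ord (leqnSn n) i).
pose h : {rmorphism {poly {mpoly R[n]}} -> {mpoly R[n.+1]}} :=
  horner_eval 'X_ord_max \o map_poly (mmap (@mpolyC n.+1 R) w).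
have hC a : h a%:P = mmap (@mpolyC n.+1 R) w a.
  by rewrite /h /= map_polyC /= /horner_eval hornerC.
have hXn k : h 'X^k = 'X_ord_max ^+ k.
  by rewrite /h /= map_polyXn /horner_eval hornerXn.
apply: (noetherian_ring_image (f := h)) => [p|]; last exact: hilbert_basis.
rewrite (mpolyE p); apply: (big_ind (fun p => exists a, h a = p)).
- by exists 0; apply: rmorph0.
- by move=> _ _ [a <-] [b <-]; exists (a + b); apply: rmorphD.
move=> m _; rewrite -mul_mpolyC mpolyXE_id.
exists ((p@_m)%:MP%:P * ((\prod_(i < n) 'X_i ^+ m (widen_ord (leqnSn n) i))%:P * 'X^(m ord_max))).
rewrite rmorphM hC mmapC; congr (_ * _).
rewrite big_ord_recr rmorphM hXn hC; congr (_ * _).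
rewrite rmorph_prod; apply: eq_bigr => i _; rewrite rmorphXn; congr (_ ^+ _).
by rewrite /= mmapX mmap1U.
Qed.

(** * The Nullstellensatz *)

Lemma rmorph_factor (P D K : pzRingType) (pi : {rmorphism P -> D})
    (theta : {rmorphism P -> K}) :
    (forall d, exists p, pi p = d) -> (forall p, pi p = 0 -> theta p = 0) ->
  exists psi : {rmorphism D -> K}, forall p, psi (pi p) = theta p.
Proof.
move=> /choice [s sK] ker_sub.
pose psi d := theta (s d).
have psiE p : psi (pi p) = theta p.
  by apply: subr0_eq; rewrite -rmorphB; apply: ker_sub; rewrite rmorphB sK subrr.
have psiB : zmod_morphism psi.
  by move=> a b; rewrite -[a]sK -[b]sK -rmorphB !psiE rmorphB.
have psiM : monoid_morphism psi.
  split=> [|a b]; first by rewrite -(rmorph1 pi) psiE rmorph1.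
  by rewrite -[a]sK -[b]sK -rmorphM !psiE rmorphM.
pose zm := GRing.isZmodMorphism.Build D K psi psiB.
pose mm := GRing.isMonoidMorphism.Build D K psi psiM.
pose Psi : {rmorphism D -> K} := HB.pack psi zm mm.
by exists Psi.
Qed.

Section SimpleExtension.
Import Pdiv.Idomain.
Variables (A D : idomainType) (iota : {rmorphism A -> D}) (x : D).
Hypothesis iota_inj : injective iota.

Let evx : {rmorphism {poly A} -> D} := horner_eval x \o map_poly iota.

Let evxC a : evx a%:P = iota a.
Proof. by rewrite /evx /= map_polyC /horner_eval hornerC. Qed.

Let evxZ a p : evx (a *: p) = iota a * evx p.
Proof. by rewrite -mul_polyC rmorphM evxC. Qed.

Hypothesis evx_surj : forall d, exists p, evx p = d.

(** If x is transcendental over A, it can be sent anywhere outside the zeros of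
    one polynomial.  If x is algebraic, let p be of minimal degree among the
    nonzero polynomials killing it: pseudo-division shows that every root of
    phi(p) is an admissible image of x as long as the leading coefficient of p
    survives, and a Bezout relation of p with the polynomial representing d
    keeps d away from zero as long as its constant term c survives. *)
Lemma extend_rmorph (K : closedFieldType) (d : D) : d != 0 ->
  exists2 a : A, a != 0 & forall phi : {rmorphism A -> K}, phi a != 0 ->
    exists psi : {rmorphism D -> K}, (forall a, psi (iota a) = phi a) /\ psi d != 0.
Proof.
have [h <-] := evx_surj d => hx0.
have h0 : h != 0 by apply: contraNneq hx0 => ->; rewrite rmorph0.
(* the extension sending x to xi *)
have ext (phi : {rmorphism A -> K}) (xi : K) :
    (forall f, evx f = 0 -> (map_poly phi f).[xi] = 0) -> (map_poly phi h).[xi] != 0 ->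
    exists psi : {rmorphism D -> K}, (forall a, psi (iota a) = phi a) /\ psi (evx h) != 0.
  move=> ker_xi h_xi.
  pose theta : {rmorphism {poly A} -> K} := horner_eval xi \o map_poly phi.
  have [psi psiE] := rmorph_factor (theta := theta) evx_surj ker_xi.
  exists psi; split=> [a|]; last by rewrite psiE.
  by rewrite -evxC psiE /theta /= map_polyC /horner_eval hornerC.
have [[p0 p0x p00]|x_tr] := pselect (exists2 p, evx p = 0 & p != 0); last first.
  exists (lead_coef h) => [|phi phih]; first by rewrite lead_coef_eq0.
  have q0 : map_poly phi h != 0.
    by rewrite -lead_coef_eq0 lead_coef_map_eq.
  (* a root xi of h X - 1 is not a root of h *)
  have /closed_rootP [xi] : size (map_poly phi h * 'X - 1) != 1%N.
    have lt1 : (size (- (1 : {poly K}))%R < size (map_poly phi h * 'X)%R)%N.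
      by rewrite size_polyN size_poly1 size_mulX // ltnS size_poly_gt0.
    by rewrite size_polyDl // size_mulX // eqSS -lt0n size_poly_gt0.
  rewrite rootE !hornerE subr_eq0 => /eqP xiE.
  apply: (ext _ xi) => [f fx|].
    have -> : f = 0 by apply/eqP/negPn/negP => f0; apply: x_tr; exists f.
    by rewrite rmorph0 horner0.
  by apply/eqP => h_xi; move/eqP: xiE; rewrite h_xi mul0r eq_sym oner_eq0.
have ex_size : exists s, `[< exists p, [/\ evx p = 0, p != 0 & size p = s] >].
  by exists (size p0); apply/asboolP; exists p0.
case: (ex_minnP ex_size) => s /asboolP [p [px p_neq0 size_p]] p_min.
have minp f : evx f = 0 -> (size f < size p)%N -> f = 0.
  move=> fx; apply: contraTeq => f0; rewrite -leqNgt size_p; apply: p_min.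
  by apply/asboolP; exists f.
have size_p_gt1 : (1 < size p)%N.
  rewrite ltnNge; apply/negP => /size1_polyC pE.
  move: p_neq0 px; rewrite pE polyC_eq0 evxC => p00_ /eqP.
  by rewrite -(rmorph0 iota) (inj_eq iota_inj) (negPf p00_).
have lcp0 : lead_coef p != 0 by rewrite lead_coef_eq0.
(* By minimality p is coprime to h, as h does not kill x. *)
have [c [v [c0 cE]]] : exists c v, c != 0 /\ (c%:P = v.1 * p + v.2 * h).
  have [g_h|g_h] := eqVneq (evx (gcdp p h)) 0.
    have := dvdp_gcdr p h; rewrite dvdp_eq => /eqP hE.
    move: hx0; have := congr1 evx hE; rewrite evxZ rmorphM g_h mulr0.
    move/eqP; rewrite mulf_eq0 => /orP [|->] //.
    rewrite -(rmorph0 iota) (inj_eq iota_inj) expf_eq0 lead_coef_eq0 gcdp_eq0.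
    by rewrite (negPf p_neq0) andbF.
  have := dvdp_gcdl p h; rewrite dvdp_eq => /eqP pE.
  have lcg0 : lead_coef (gcdp p h) ^+ scalp p (gcdp p h) != 0.
    by rewrite expf_neq0 // lead_coef_eq0 gcdp_eq0 (negPf p_neq0).
  have q0 : p %/ gcdp p h != 0.
    apply: contraTneq isT => q0; move/eqP: pE; rewrite q0 mul0r -mul_polyC mulf_eq0 polyC_eq0.
    by rewrite (negPf lcg0) (negPf p_neq0).
  have g0 : gcdp p h != 0 by rewrite gcdp_eq0 (negPf p_neq0).
  have qx : evx (p %/ gcdp p h) = 0.
    have := congr1 evx pE; rewrite evxZ px mulr0 rmorphM => /esym/eqP.
    by rewrite mulf_eq0 (negPf g_h) orbF => /eqP.
  have size_g : size (gcdp p h) = 1%N.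
    have le_pq : (size p <= size (p %/ gcdp p h)%R)%N.
      by rewrite leqNgt; apply/negP => /(minp _ qx)/eqP; rewrite (negPf q0).
    have := congr1 (size \o (@polyseq A)) pE; rewrite /= size_scale // size_mul // => sE.
    apply/eqP; rewrite eqn_leq size_poly_gt0 g0 andbT -(leq_add2l (size p)) addn1.
    rewrite (leq_trans (leq_add le_pq (leqnn _))) //.
    by rewrite sE prednK // addn_gt0 size_poly_gt0 q0.
  have [u /eqpP [[c1 c2] /= /andP [c10 c20] uE]] := Bezoutp p h.
  move/eqP: size_g => /size_poly1P [g g_neq0 gE].
  exists (c2 * g), (c1 *: u.1, c1 *: u.2); split; first exact: mulf_neq0.
  by rewrite /= -!scalerAl -scalerDr uE gE polyCM mul_polyC.
exists (c * lead_coef p) => [|phi]; first exact: mulf_neq0.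
rewrite rmorphM mulf_eq0 negb_or => /andP [phic philc].
have size_pp : size (map_poly phi p) = size p by rewrite size_map_poly_id0.
have /closed_rootP [xi /eqP p_xi] : size (map_poly phi p) != 1%N.
  by rewrite size_pp neq_ltn size_p_gt1 orbT.
apply: (ext _ xi) => [f fx|].
  have fE' : lead_coef p ^+ scalp f p *: f = f %/ p * p + f %% p by exact: divp_eq.
  have r0 : f %% p = 0.
    apply: minp; last by rewrite ltn_modp.
    have := congr1 evx fE'; rewrite evxZ fx mulr0 rmorphD rmorphM px mulr0 add0r.
    by move/esym.
  have := congr1 (fun q => (map_poly phi q).[xi]) fE'.
  rewrite r0 addr0 rmorphM hornerM p_xi mulr0 -mul_polyC rmorphM hornerM.
  rewrite /= map_polyC /= hornerC => /eqP; rewrite mulf_eq0 rmorphXn expf_eq0.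
  by rewrite (negPf philc) andbF => /eqP.
apply: contraNneq phic => h_xi; have := congr1 (fun q => (map_poly phi q).[xi]) cE.
by rewrite /= map_polyC hornerC rmorphD !rmorphM hornerD !hornerM p_xi h_xi !mulr0 addr0 => ->.
Qed.

End SimpleExtension.

Section KernelIdeal.
Variables (R : comNzRingType) (D : idomainType) (f : {rmorphism R -> D}).

Definition rker : R -> bool := fun a => f a == 0.

Lemma rker_idealr_closed : idealr_closed rker.
Proof.
split=> [||a u v]; rewrite /in_mem /= /rker ?rmorph0 ?rmorph1 ?oner_eq0 //.
by rewrite rmorphD rmorphM => /eqP -> /eqP ->; rewrite mulr0 addr0.
Qed.

Lemma rker_prime : prime_idealr_closed rker.
Proof. by move=> u v; rewrite /in_mem /= /rker rmorphM mulf_eq0. Qed.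

HB.instance Definition _ := isIdealr.Build R rker rker_idealr_closed.
HB.instance Definition _ := isPrimeIdealrClosed.Build R rker rker_prime.

End KernelIdeal.

Lemma pq_pi_surj (A : comNzRingType) (p : prime_idealr A) (x : prime_quot p) :
  exists a, pq_pi p a = x.
Proof. by exists (repr x); apply: reprK. Qed.

Lemma pq_pi_eq0 (A : comNzRingType) (p : prime_idealr A) (a : A) :
  (pq_pi p a == 0) = p a.
Proof.
rewrite -(rmorph0 (pq_pi p)).
by have := Quotient.idealrBE p a 0; rewrite subr0 => <-.
Qed.

(** Turns a subring of a domain into a domain in its own right, as needed for
    the induction on the number of generators in [domain_point]. *)
Lemma image_factor (R : comNzRingType) (D : idomainType) (f : {rmorphism R -> D}) :
  exists (A : idomainType) (pi : {rmorphism R -> A}) (iota : {rmorphism A -> D}),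
    [/\ forall a, exists r, pi r = a, injective iota & forall r, iota (pi r) = f r].
Proof.
pose p : prime_idealr R := rker f.
have ker_f q : pq_pi p q = 0 -> f q = 0.
  by move/eqP; rewrite pq_pi_eq0 => /eqP.
have [iota iotaE] := rmorph_factor (@pq_pi_surj _ p) ker_f.
exists (prime_quot p), (pq_pi p), iota; split=> //; first exact: pq_pi_surj.
apply: raddf_inj => a; have [q <-] := pq_pi_surj a.
by move=> q0; apply/eqP; rewrite pq_pi_eq0; apply/eqP; rewrite -iotaE.
Qed.

(** A nonzero element of a domain finitely generated over an algebraically closed
    field survives at some rational point.  Induction on the number of
    generators: [extend_rmorph] turns the question into the same one for the
    subring generated by all generators but the last. *)
Lemma domain_point (K : closedFieldType) (m : nat) (D : idomainType)
    (sigma : {rmorphism K -> D}) (x : 'I_m -> D) (d : D) :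
    (forall b, exists p : {mpoly K[m]}, b = mmap sigma x p) -> d != 0 ->
  exists psi : {rmorphism D -> K}, (forall c, psi (sigma c) = c) /\ psi d != 0.
Proof.
elim: m => [|m IHm] in D sigma x d * => gen d0.
  have sigma_surj b : exists c, sigma c = b.
    have [p ->] := gen b; exists p@_0%MM.
    have -> : p = (p@_0%MM)%:MP.
      apply/mpolyP => k; rewrite mcoeffC.
      have -> : k = 0%MM by apply/mnmP => - [].
      by rewrite eqxx mulr1.
    by rewrite mcoeffC eqxx mulr1 mmapC.
  have ker0 c : sigma c = 0 -> idfun c = 0.
    by move/eqP; rewrite fmorph_eq0 => /eqP.
  have [psi psiE] := rmorph_factor sigma_surj ker0.
  exists psi; split=> //; have [c cE] := sigma_surj d.
  by rewrite -cE psiE /=; apply: contraNneq d0 => c0; rewrite -cE c0 rmorph0.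
pose w (i : 'I_m) : D := x (widen_ord (leqnSn m) i).
pose f : {rmorphism {mpoly K[m]} -> D} := mmap sigma w.
have [A [pi [iota [pi_surj iota_inj iotaE]]]] := image_factor f.
pose evx : {rmorphism {poly A} -> D} := horner_eval (x ord_max) \o map_poly iota.
have evxC a : evx a%:P = iota a by rewrite /evx /= map_polyC /horner_eval hornerC.
have evxXn k : evx 'X^k = x ord_max ^+ k.
  by rewrite /evx /= map_polyXn /horner_eval hornerXn.
have evx_surj b : exists q, evx q = b.
  have [q ->] := gen b; rewrite /mmap; apply: (big_ind (fun b => exists q, evx q = b)).
  - by exists 0; apply: rmorph0.
  - by move=> _ _ [u <-] [v <-]; exists (u + v); apply: rmorphD.
  move=> k _; rewrite /mmap1 big_ord_recr.
  exists ((pi (q@_k)%:MP)%:P * ((pi (\prod_(i < m) 'X_i ^+ k (widen_ord (leqnSn m) i)))%:P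
    * 'X^(k ord_max))).
  rewrite 2!rmorphM !evxC evxXn !iotaE; congr (_ * (_ * _)); first by rewrite /f /= mmapC.
  rewrite rmorph_prod; apply: eq_bigr => i _; rewrite rmorphXn; congr (_ ^+ _).
  by rewrite /f /= mmapX mmap1U.
have [a a0 ext] := extend_rmorph iota_inj evx_surj K d0.
pose sA : {rmorphism K -> A} := pi \o @mpolyC m K.
have [b|phi [phiK phia]] := IHm A sA (fun i => pi 'X_i) a _ a0.
  have [q <-] := pi_surj b; exists q.
  rewrite {1}(mpolyE q) rmorph_sum /mmap; apply: eq_bigr => k _.
  rewrite -mul_mpolyC rmorphM; congr (_ * _).
  rewrite mpolyXE_id rmorph_prod; apply: eq_bigr => i _; exact: rmorphXn.
have [psi [psiE psid]] := ext phi phia.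
exists psi; split=> // c; rewrite -[RHS]phiK -psiE /sA /= iotaE /f /=.
by rewrite mmapC.
Qed.

(** An ideal that is maximal among those containing no power of b is prime. *)
Lemma prime_avoiding_powers (A : comNzRingType) (b : A) :
    (forall k, b ^+ k <> 0) ->
  exists p : prime_idealr A, ~~ p b.
Proof.
move=> b_nil.
pose good (I : A -> Prop) := (forall a u v, I u -> I v -> I (a * u + v)) /\
  forall k, ~ I (b ^+ k).
(* [good] admits the empty set, the union of the empty chain. *)
have [F sub_F tot_F|I [[IM Ib] Imax]] := @classical_sets.Zorn_bigcup A good.
- split=> [a u v [X FX Xu] [Y FY Yv]|k [X FX]]; last exact: (sub_F X FX).2.
  have [XY|YX] := tot_F X Y FX FY.
    by exists Y => //; apply: (sub_F Y FY).1 => //; apply: XY.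
  by exists X => //; apply: (sub_F X FX).1 => //; apply: YX.
have max_in J : good J -> (forall a, I a -> J a) -> forall a, J a -> I a.
  move=> gJ IJ a Ja; apply: contrapT => nIa; apply: (Imax J) => //.
  by split=> // /(_ a Ja).
have I0 : I 0.
  have [[u Iu]|nI] := pselect (exists u, I u).
    by rewrite -(addNr u) -mulN1r; apply: IM.
  apply: (max_in (fun a => a = 0)) => //; last by move=> a Ia; case: nI; exists a.
  by split=> // a u v -> ->; rewrite mulr0 addr0.
pose J u (a : A) := exists i c, I i /\ a = i + c * u.
have J_pow u : ~ I u -> exists k, J u (b ^+ k).
  move=> nIu; apply: contrapT => nJ; apply: nIu; apply: (max_in (J u)).
  - split=> [a _ _ [i [c [Ii ->]]] [j [e [Ij ->]]]|k Jk]; last by apply: nJ; exists k.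
    exists (a * i + j), (a * c + e); split; first exact: IM.
    by rewrite mulrDr mulrA mulrDl addrACA.
  - by move=> a Ia; exists a, 0; rewrite mul0r addr0.
  - by exists 0, 1; rewrite add0r mul1r.
pose S (a : A) : bool := `[< I a >].
have S_ideal : idealr_closed S.
  split=> [||a u v /asboolP Iu /asboolP Iv]; first exact/asboolP.
    by apply/asboolP; rewrite -(expr0 b); apply: Ib.
  by apply/asboolP; apply: IM.
have S_prime : prime_idealr_closed S.
  move=> u v /asboolP Iuv; apply/orP.
  have [/asboolP|nIu] := pselect (I u); first by left.
  have [/asboolP|nIv] := pselect (I v); first by right.
  have [k [i [c [Ii bk]]]] := J_pow u nIu.
  have [l [j [e [Ij bl]]]] := J_pow v nIv.
  case: (Ib (k + l)%N); rewrite exprD {1}bk bl.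
  have -> : (i + c * u) * (j + e * v) = (j + e * v) * i + ((c * u) * j + (c * e * (u * v) + 0)).
    rewrite mulrDl [i * _]mulrC addr0 mulrDr; congr (_ + (_ + _)).
    by rewrite -!mulrA; congr (_ * _); rewrite mulrCA.
  by apply: (IM) => //; apply: (IM) => //; apply: IM.
pose ii := isIdealr.Build A S S_ideal.
pose pp := isPrimeIdealrClosed.Build A S S_prime.
pose p : prime_idealr A := HB.pack S ii pp.
by exists p; apply/asboolP; rewrite -[b]expr1; apply: Ib.
Qed.

(** Hilbert's Nullstellensatz: pass to the quotient by a prime ideal containing
    no power of b. *)
Theorem nullstellensatz (K : closedFieldType) (A : comAlgType K) (b : A) :
    finitely_generated_algebra A ->
    (forall eps : {rmorphism A -> K}, (forall c, eps c%:A = c) -> eps b = 0) ->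
  exists k, b ^+ k = 0.
Proof.
move=> [m [x gen]] b_van; apply: contrapT => b_nil.
have [p pb] : exists p : prime_idealr A, ~~ p b.
  by apply: prime_avoiding_powers => k bk; apply: b_nil; exists k.
pose D : idomainType := prime_quot p.
pose sigma : {rmorphism K -> D} := pq_pi p \o in_alg A.
have [c||psi [psiK psib]] := @domain_point K m D sigma (fun i => pq_pi p (x i)) (pq_pi p b).
- have [a <-] := pq_pi_surj c; have [q ->] := gen a; exists q.
  rewrite /mmap rmorph_sum; apply: eq_bigr => k _.
  rewrite rmorphM; congr (_ * _).
  by rewrite /mmap1 rmorph_prod; apply: eq_bigr => i _; apply: rmorphXn.
- by rewrite pq_pi_eq0.
move/eqP: psib; apply; exact: (b_van (psi \o pq_pi p)).
Qed.

(** * The Koszul complex *)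

(** The terms cancel in pairs indexed by k < l, so 2 need not be invertible. *)
Lemma antisym_sum (V : zmodType) (d : nat) (P : 'I_d -> 'I_d -> bool)
    (F : 'I_d -> 'I_d -> V) :
    (forall k l, P k l = P l k) -> (forall k, ~~ P k k) ->
    (forall k l, P k l -> F k l = - F l k) ->
  \sum_k \sum_(l | P k l) F k l = 0.
Proof.
move=> Psym Pirr Fanti.
rewrite (eq_bigr (fun k : 'I_d => \sum_(l | P k l && (k < l)%N) F k l
  + \sum_(l | P k l && (l < k)%N) F k l)); last first.
  move=> k _; rewrite (bigID (fun l : 'I_d => (k < l)%N)) /=; congr (_ + _).
  apply: eq_bigl => l; case: ltngtP => //; rewrite ?andbF ?andbT // => /val_inj ->.
  by rewrite (negPf (Pirr l)).
rewrite big_split /= [X in _ + X](exchange_big_dep xpredT) //= -big_split /=.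
apply: big1 => k _; rewrite [X in _ + X](eq_bigl (fun l => P k l && (k < l)%N)); last first.
  by move=> l; rewrite Psym.
rewrite -big_split /=; apply: big1 => l /andP [Pkl _].
by rewrite Fanti // addNr.
Qed.

Section KoszulComplex.
Variables (T : comPzRingType) (d : nat) (y : 'I_d -> T).

Definition ksign (J : {set 'I_d}) (k : nat) : T :=
  (-1) ^+ #|[set j in J | (j < k)%N]|.

Lemma ksignU1 (J : {set 'I_d}) (l : 'I_d) (k : nat) :
  l \notin J -> ksign (l |: J) k = (if (l < k)%N then -1 else 1) * ksign J k.
Proof.
move=> lJ; rewrite /ksign; case: ifP => lk.
  have -> : [set j in l |: J | (j < k)%N] = l |: [set j in J | (j < k)%N].
    apply/setP => j; rewrite !inE; case: eqP => [->|] //=.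
  by rewrite cardsU1 inE (negPf lJ) /= exprS.
have -> : [set j in l |: J | (j < k)%N] = [set j in J | (j < k)%N].
  by apply/setP => j; rewrite !inE; case: eqP => [->|] //=; rewrite lk (negPf lJ).
by rewrite mul1r.
Qed.

Lemma ksign_sqr J k : ksign J k * ksign J k = 1.
Proof. by rewrite -expr2 /ksign sqrr_sign. Qed.

Lemma ksign0 k : ksign set0 k = 1.
Proof.
rewrite /ksign (_ : [set j in _ | _] = set0) ?cards0 //.
by apply/setP => j; rewrite !inE.
Qed.

Section Module.
Variable N : lmodType T.
Implicit Types (w : koszul_chain d N) (J : {set 'I_d}).
Local Notation dd := (koszul_diff y).

Lemma kdiffE w J :
  dd w J = \sum_(k < d | k \notin J) (ksign J k * y k) *: w (k |: J).
Proof. by rewrite ffunE. Qed.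

Lemma kdiffD w w' : dd (w + w' : {ffun _ -> _}) = (dd w + dd w' : {ffun _ -> _}).
Proof.
apply/ffunP => J; rewrite [RHS]ffunE !kdiffE -big_split /=.
by apply: eq_bigr => l _; rewrite ffunE scalerDr.
Qed.

Lemma kdiffB w w' : dd (w - w' : {ffun _ -> _}) = (dd w - dd w' : {ffun _ -> _}).
Proof. by apply/eqP; rewrite eq_sym subr_eq -kdiffD subrK. Qed.

Lemma kdiff_deg i w : koszul_deg i.+1 w -> koszul_deg i (dd w).
Proof.
move=> dw J Ji; rewrite kdiffE big1 // => k kJ; rewrite dw ?scaler0 //.
by rewrite cardsU1 kJ /= add1n => - [].
Qed.

Lemma kdiff_comp w : dd (dd w) = 0.
Proof.
apply/ffunP => J; rewrite kdiffE [RHS]ffunE.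
rewrite (eq_bigr (fun k => \sum_(l | (l != k) && (l \notin J))
  (ksign J k * y k * (ksign (k |: J) l * y l)) *: w (l |: (k |: J)))); last first.
  move=> k kJ; rewrite kdiffE scaler_sumr; apply: eq_big => [l|l _].
    by rewrite !inE negb_or.
  by rewrite scalerA.
rewrite big_mkcond /= (eq_bigr (fun k => \sum_(l | [&& k != l, k \notin J & l \notin J])
  (ksign J k * y k * (ksign (k |: J) l * y l)) *: w (l |: (k |: J)))); last first.
  move=> k _; case: ifP => kJ.
    by apply: eq_bigl => l; rewrite eq_sym.
  by rewrite big_pred0 // => l; rewrite andbF.
apply: antisym_sum => [k l|k|k l /and3P [kl kJ lJ]].
- by rewrite eq_sym [(k \notin _) && _]andbC.
- by rewrite eqxx.
rewrite setUCA -scaleNr; congr (_ *: _); rewrite !ksignU1 //.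
have := kl; rewrite -val_eqE neq_ltn /= => /orP [] lt_kl; rewrite lt_kl ltnNge (ltnW lt_kl) /=.
  rewrite !mul1r !mulN1r !mulNr !mulrN; congr (- _).
  by rewrite mulrACA [RHS]mulrACA [ksign J l * _]mulrC [y l * _]mulrC.
rewrite !mul1r !mulN1r !mulNr !mulrN opprK.
by rewrite mulrACA [RHS]mulrACA [ksign J l * _]mulrC [y l * _]mulrC.
Qed.

Lemma kdiff_set0 w : dd w set0 = \sum_j y j *: w [set j].
Proof.
rewrite kdiffE; apply: eq_big => [j|j _]; first by rewrite in_set0.
by rewrite setU0 ksign0 mul1r.
Qed.

Lemma kdiff_syzygy w : \sum_j y j *: dd w [set j] = 0.
Proof. by rewrite -kdiff_set0 kdiff_comp ffunE. Qed.

(** Left multiplication by e_j is a homotopy from y_j to 0; on cycles this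
    shows that y_j annihilates homology. *)
Lemma koszul_homotopy i w j : koszul_deg i w -> dd w = 0 ->
  exists w', koszul_deg i.+1 w' /\ forall J, dd w' J = y j *: w J.
Proof.
move=> dw cw.
exists [ffun J : {set 'I_d} => if j \in J then ksign J j *: w (J :\ j) else 0].
split=> J.
  move=> Ji; rewrite ffunE; case: ifP => // jJ; rewrite dw ?scaler0 // => Ji'.
  by apply: Ji; rewrite (cardsD1 j) jJ Ji'.
rewrite kdiffE; have [jJ|jJ] := boolP (j \in J); last first.
  rewrite (bigD1 j) //= big1 ?addr0 => [|k /andP [kJ kj]].
    rewrite ffunE setU11 setU1K // ksignU1 // ltnn mul1r scalerA.
    by rewrite mulrAC ksign_sqr mul1r.
  by rewrite ffunE !inE eq_sym (negPf kj) (negPf jJ) scaler0.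
set J' := J :\ j; have jJ' : j \notin J' by rewrite !inE eqxx.
have JE : J = j |: J' by rewrite setD1K.
have := congr1 (fun v : koszul_chain d N => v J') cw.
rewrite kdiffE [X in _ = X]ffunE (bigD1 j) //= -JE => /eqP.
rewrite addrC addr_eq0 => /eqP sumE.
have -> : y j *: w J = (- ksign J' j) *: - ((ksign J' j * y j) *: w J).
  by rewrite scalerN scaleNr opprK scalerA mulrA ksign_sqr mul1r.
rewrite -sumE scaler_sumr; apply: eq_big => [k|k kJ].
  by rewrite JE !inE negb_or andbC; case: eqP => //= ->; rewrite !andbF.
have kj : k != j by apply: contraNneq kJ => ->.
have kJ' : k \notin J' by rewrite !inE (negPf kJ) andbF.
rewrite ffunE !inE jJ orbT !scalerA.
have -> : (k |: J) :\ j = k |: J'.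
  apply/setP => l; rewrite !inE; case: (eqVneq l j) => //= ->.
  by rewrite eq_sym (negPf kj).
congr (_ *: _); rewrite [ksign (k |: J) j]ksignU1 // JE !ksignU1 // ltnn mul1r.
have := kj; rewrite -val_eqE neq_ltn /= => /orP [] lt_kj; rewrite lt_kj ltnNge (ltnW lt_kj) /=.
  by rewrite mul1r !mulN1r !mulrN mulNr; congr (- _); rewrite mulrC mulrA.
by rewrite mul1r !mulN1r !mulNr; congr (- _); rewrite mulrC mulrA.
Qed.

End Module.

Lemma kdiff_map (T' : comPzRingType) (phi : {rmorphism T -> T'}) (N : lmodType T)
    (N' : lmodType T') (f : N -> N') (w : koszul_chain d N) :
    {morph f : u v / u + v} -> (forall a v, f (a *: v) = phi a *: f v) ->
  koszul_diff (phi \o y) ([ffun J => f (w J)] : koszul_chain d N') =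
    [ffun J => f (koszul_diff y w J)].
Proof.
move=> fD fZ; have f0 : f 0 = 0 by apply: (addIr (f 0)); rewrite -fD !add0r.
apply/ffunP => J; rewrite !ffunE (big_morph f fD f0).
by apply: eq_bigr => k _; rewrite fZ ffunE rmorphM rmorphXn rmorphN1.
Qed.

Hypothesis y_reg : regular_sequence y.

(** The chains of the Koszul complex of the first k elements of y. *)
Definition ksupp (k : nat) (w : koszul_chain d T^o) : Prop :=
  forall (J : {set 'I_d}) (j : 'I_d), j \in J -> (k <= j)%N -> w J = 0.

(** The Koszul complex of a regular sequence is acyclic in positive degrees.
    Adjoin the elements one at a time: the component of a cycle along e_k is a
    cycle for the previous elements, hence a boundary (in degree 0 because y_k
    is a nonzerodivisor modulo them), and can be removed by subtracting a
    boundary. *)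
Lemma koszul_acyclic_partial k i (w : koszul_chain d T^o) :
    (k <= d)%N -> ksupp k w -> koszul_deg i.+1 w -> koszul_diff y w = 0 ->
  exists w' : koszul_chain d T^o,
    [/\ ksupp k w', koszul_deg i.+2 w' & koszul_diff y w' = w].
Proof.
elim: k i w => [|k IHk] i w le_kd sw dw cw.
  exists 0; split=> [J j _ _|J _|]; rewrite ?ffunE //.
  apply/ffunP => J; rewrite kdiffE big1 => [|l _]; last by rewrite ffunE scaler0.
  have [->|[j jJ]] := set_0Vmem J; first by rewrite dw // cards0.
  by rewrite (sw J j).
pose kk := Ordinal le_kd.
pose low (J : {set 'I_d}) := [forall j in J, (j < k)%N].
have not_low (J : {set 'I_d}) (l : 'I_d) : l \in J -> (k <= l)%N -> low J = false.
  move=> lJ kl; apply/negbTE/forall_inPn; exists l => //; by rewrite -leqNgt.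
have lowU1 (J : {set 'I_d}) l : low (l |: J) -> low J.
  by move=> /forall_inP lJ; apply/forall_inP => j jJ; apply: lJ; rewrite inE jJ orbT.
pose w1 : koszul_chain d T^o := [ffun J : {set 'I_d} => if low J then w (kk |: J) else 0].
have kk_notin J : low J -> kk \notin J.
  by move=> lJ; apply/negP => kJ; move: lJ; rewrite (not_low _ kk).
have sw1 : ksupp k w1 by move=> J j jJ kj; rewrite ffunE (not_low _ j).
have dw1 : koszul_deg i w1.
  move=> J Ji; rewrite ffunE; case: ifP => // lJ; apply: dw.
  by rewrite cardsU1 kk_notin // => - [].
(* the e_k-component of the differential *)
have diff_kk (J : {set 'I_d}) (u u' : koszul_chain d T^o) : kk \notin J ->
    (forall l : 'I_d, (k < l)%N -> u (l |: (kk |: J)) = 0) ->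
    (forall l : 'I_d, (k <= l)%N -> u' (l |: J) = 0) ->
    (forall l : 'I_d, (l < k)%N -> u (l |: (kk |: J)) = u' (l |: J)) ->
    koszul_diff y u (kk |: J) = koszul_diff y u' J.
  move=> kJ u0 u'0 uu'; rewrite !kdiffE big_mkcond [RHS]big_mkcond /=.
  apply: eq_bigr => l _; rewrite !inE negb_or.
  have [->|nlk] := eqVneq l kk; first by rewrite /= kJ u'0 // scaler0.
  case: (boolP (l \notin J)) => //= lJ; rewrite ksignU1 //=.
  have := nlk; rewrite -val_eqE neq_ltn /=; case: ltngtP => //= lk _.
    by rewrite mul1r uu'.
  by rewrite u0 // u'0 ?scaler0 // ltnW.
have cw1 : koszul_diff y w1 = 0.
  apply/ffunP => J; rewrite [RHS]ffunE; have [lJ|lJ] := boolP (low J); last first.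
    rewrite kdiffE big1 // => l _; rewrite ffunE.
    by case: ifP => [/lowU1|_]; rewrite ?(negPf lJ) ?scaler0.
  rewrite -(diff_kk _ w) ?cw ?ffunE ?kk_notin // => l lk.
  - by rewrite (sw _ l) ?setU11.
  - by rewrite (sw1 _ l) ?setU11.
  rewrite ffunE setUCA; case: ifP => // /negP []; apply/forall_inP => j.
  by rewrite in_setU1 => /orP [/eqP ->//|jJ]; apply: (forall_inP lJ).
have [u1 [su1 du1 eu1]] : exists u1 : koszul_chain d T^o,
    [/\ ksupp k u1, koszul_deg i.+1 u1 & koszul_diff y u1 = w1].
  (* in degree 1 the component w1 is a scalar, and regularity applies *)
  case: i dw dw1 => [|i] dw dw1; last exact: IHk (ltnW le_kd) sw1 dw1 cw1.
  have [c cE] : in_span y [pred j : 'I_d | (j < kk)%N] (w [set kk]).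
    apply: y_reg.2; have := congr1 (fun v : koszul_chain d T^o => v set0) cw.
    rewrite kdiffE [X in _ = X]ffunE.
    rewrite (bigD1 kk) ?inE //= setU0 ksign0 mul1r => /eqP; rewrite addr_eq0 => /eqP.
    rewrite /GRing.scale /= => ->.
    exists (fun l => - w [set l]); rewrite -sumrN big_mkcond [RHS]big_mkcond /=.
    apply: eq_bigr => l _; rewrite inE /= setU0 ksign0 mul1r mulNr [w _ * _]mulrC.
    rewrite -val_eqE neq_ltn /=; case: ltngtP => //= kl.
    by rewrite (sw _ l) ?inE // mulr0 oppr0.
  exists [ffun J : {set 'I_d} => \sum_(l < d | (l < k)%N && (J == [set l])) c l].
  split=> [J j jJ kj|J J1|].
  - rewrite ffunE big_pred0 // => l; case: eqP => [JE|]; rewrite ?andbF //.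
    by move: jJ kj; rewrite JE inE => /eqP ->; rewrite leqNgt andbT => /negPf ->.
  - rewrite ffunE big_pred0 // => l; case: eqP => [JE|]; rewrite ?andbF //.
    by case: J1; rewrite JE cards1.
  apply/ffunP => J; rewrite kdiffE.
  have [->|J0] := eqVneq J set0.
    rewrite ffunE ifT; last by apply/forall_inP => j; rewrite inE.
    rewrite setU0 cE big_mkcond [RHS]big_mkcond; apply: eq_bigr => l _.
    rewrite in_set0 /= ffunE setU0 ksign0 mul1r.
    case: ifP => lk.
      rewrite (big_pred1 l) => [|j]; first exact: mulrC.
      by rewrite /= (inj_eq set1_inj) [l == j]eq_sym; case: eqP => [->|]; rewrite ?lk ?andbF.
    rewrite big_pred0 ?scaler0 // => j; rewrite (inj_eq set1_inj).
    by case: eqP => [<-|]; rewrite ?lk ?andbF.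
  rewrite dw1; last by move/eqP; rewrite cards_eq0 (negPf J0).
  rewrite big1 // => l lJ; rewrite ffunE big_pred0 ?scaler0 // => j.
  case: eqP => [/(congr1 (fun A : {set 'I_d} => #|A|))|]; rewrite ?andbF //.
  by rewrite cardsU1 lJ cards1 add1n => - [] /eqP; rewrite cards_eq0 (negPf J0).
(* u1 wedge e_k, whose differential has the same e_k-component as w *)
pose u2 : koszul_chain d T^o := [ffun J : {set 'I_d} => if kk \in J then u1 (J :\ kk) else 0].
have du2 : koszul_deg i.+2 u2.
  move=> J Ji; rewrite ffunE; case: ifP => // kJ; apply: du1 => Ji'.
  by apply: Ji; rewrite (cardsD1 kk) kJ Ji'.
have su2 : ksupp k.+1 u2.
  move=> J j jJ kj; rewrite ffunE; case: ifP => // kJ.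
  by rewrite (su1 _ j) ?(ltnW kj) // !inE jJ -val_eqE /= gtn_eqF.
pose v : koszul_chain d T^o := w - koszul_diff y u2.
have vE J : v J = w J - koszul_diff y u2 J by rewrite !ffunE.
have sv : ksupp k v.
  move=> J j jJ kj; rewrite vE; have [kJ|kJ] := boolP (kk \in J); last first.
    have lt_kj : (k < j)%N.
      rewrite ltn_neqAle kj andbT; apply: contraNneq kJ => kE.
      by rewrite (_ : kk = j) //; apply: val_inj.
    rewrite (sw _ j) // sub0r kdiffE big1 ?oppr0 // => l _.
    by rewrite (su2 _ j) ?scaler0 // inE jJ orbT.
  have {1 2}-> : J = kk |: (J :\ kk) by rewrite setD1K.
  have kJ' : kk \notin J :\ kk by rewrite !inE eqxx.
  have -> : koszul_diff y u2 (kk |: J :\ kk) = w1 (J :\ kk).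
    rewrite -eu1; apply: diff_kk => // l kl.
    - by rewrite (su2 _ l) ?setU11.
    - by rewrite (su1 _ l) ?setU11.
    rewrite ffunE !inE eqxx orbT; congr (u1 _); apply/setP => j'; rewrite !inE.
    case: (eqVneq j' kk) => //= ->; rewrite orbF; apply/esym/negbTE.
    by rewrite -val_eqE /= gtn_eqF.
  rewrite ffunE; case: ifP => [_|/negbT/forall_inPn [l lJ kl]]; first exact: subrr.
  have [nlk {}lJ] := setD1P lJ.
  rewrite subr0 (sw _ l) ?inE ?lJ ?nlk ?orbT //.
  by rewrite ltn_neqAle leqNgt kl andbT eq_sym; move: nlk; rewrite -val_eqE.
have dv : koszul_deg i.+1 v.
  by move=> J Ji; rewrite vE dw // (kdiff_deg du2) // subrr.
have cv : koszul_diff y v = 0 by rewrite kdiffB cw kdiff_comp subrr.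
have [u0 [su0 du0 eu0]] := IHk i v (ltnW le_kd) sv dv cv.
exists (u0 + u2 : {ffun _ -> _}); split=> [J j jJ kj|J Ji|].
- by rewrite ffunE (su0 _ j) ?(ltnW kj) // (su2 _ j) // addr0.
- by rewrite ffunE du0 // du2 // addr0.
by rewrite kdiffD eu0 subrK.
Qed.

Theorem regular_koszul_acyclic i (w : koszul_chain d T^o) :
    koszul_deg i.+1 w -> koszul_diff y w = 0 ->
  exists w' : koszul_chain d T^o, koszul_deg i.+2 w' /\ koszul_diff y w' = w.
Proof.
move=> dw cw; have [|w' [_ dw' cw']] := koszul_acyclic_partial (leqnn d) _ dw cw.
  by move=> J j _; rewrite leqNgt ltn_ord.
by exists w'.
Qed.

End KoszulComplex.

(** * Denominators, linear algebra and Cramer's rule *)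

Section Fractions.
Variable R : idomainType.

Lemma fraction_den (x : {fraction R}) :
  exists e c : R, e != 0 /\ tofrac e * x = tofrac c.
Proof.
elim/quotW: x => x; exists (x : R * R)%type.2, (x : R * R)%type.1.
split; first exact: denom_ratioP.
rewrite -[tofrac _ * _]/(FracField.mul _ _) !piE; apply/eqP; rewrite FracField.equivf_def.
rewrite /FracField.mulf !numden_Ratio ?mul1r ?oner_neq0 ?denom_ratioP //.
by rewrite mulr1.
Qed.

(** Finitely many conditions that each hold for all multiples of some nonzero
    element hold together for some nonzero element. *)
Lemma common_multiple (I : finType) (Q : I -> R -> Prop) :
    (forall i e f, Q i e -> Q i (f * e)) -> (forall i, exists2 e, e != 0 & Q i e) ->
  exists2 e, e != 0 & forall i, Q i e.
Proof.
move=> QM Qex; have /choice [e eP] i : exists e, e != 0 /\ Q i e.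
  by have [e] := Qex i; exists e.
exists (\prod_i e i) => [|i]; first by apply/prodf_neq0 => i _; case: (eP i).
by rewrite (bigD1 i) //= mulrC; apply: QM; case: (eP i).
Qed.

Lemma common_den (I : finType) (a : I -> {fraction R}) :
  exists2 e : R, e != 0 & exists c : I -> R, forall i, tofrac e * a i = tofrac (c i).
Proof.
have [|i|e e0 He] := @common_multiple I (fun i e => exists c, tofrac e * a i = tofrac c).
- by move=> i e f [c ec]; exists (f * c); rewrite !rmorphM -mulrA ec.
- by have [e [c [e0 ec]]] := fraction_den (a i); exists e => //; exists c.
by have [c cP] := choice He; exists e => //; exists c.
Qed.
End Fractions.

Section LinearAlgebra.
Variables (L : fieldType) (V : lmodType L).

Definition indep r (b : 'I_r -> V) : Prop :=
  forall a : 'I_r -> L, \sum_i a i *: b i = 0 -> forall i, a i = 0.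

Definition spans r (b : 'I_r -> V) : Prop :=
  forall v, exists a : 'I_r -> L, v = \sum_i a i *: b i.

Lemma basisP r :
  has_basis_of_size V r <-> exists b : 'I_r -> V, indep b /\ spans b.
Proof.
split=> [[b bP]|[b [ib sb]]]; exists b.
  split=> [a a0 i|v]; last by have [a [-> _]] := bP v; exists a.
  have [a' [_ a'u]] := bP 0.
  have a'E : a' = [ffun i => a i].
    by apply: a'u; rewrite (eq_bigr (fun i => a i *: b i)) // => j _; rewrite ffunE.
  have a'0 : a' = 0 by apply: a'u; rewrite big1 // => j _; rewrite ffunE scale0r.
  by have := congr1 (fun f : {ffun 'I_r -> L} => f i) a'E; rewrite a'0 !ffunE => <-.
move=> v; have [a vE] := sb v; exists [ffun i => a i]; split=> [|a' vE'].
  by rewrite (eq_bigr (fun i => a i *: b i)) // => i _; rewrite ffunE.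
apply/ffunP => i; rewrite ffunE; apply: subr0_eq.
move: i; apply: ib; rewrite (eq_bigr (fun i => a i *: b i - a' i *: b i)) => [|i _].
  by rewrite sumrB -vE -vE' subrr.
by rewrite scalerBl.
Qed.

Lemma spans_matrix r s (b : 'I_r -> V) (c : 'I_s -> V) : spans b ->
  exists A : 'M[L]_(s, r), forall i, c i = \sum_j A i j *: b j.
Proof.
move=> sb; have /choice [a aP] := fun i => sb (c i).
by exists (\matrix_(i, j) a i j) => i; rewrite aP; apply: eq_bigr => j _; rewrite mxE.
Qed.

Lemma sum_mulmx r s (b : 'I_r -> V) (c : 'I_s -> V) (A : 'M[L]_(s, r)) (u : 'rV[L]_s) :
    (forall i, c i = \sum_j A i j *: b j) ->
  \sum_i u 0 i *: c i = \sum_j (u *m A) 0 j *: b j.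
Proof.
move=> cE; rewrite (eq_bigr (fun i => \sum_j (u 0 i * A i j) *: b j)); last first.
  by move=> i _; rewrite cE scaler_sumr; apply: eq_bigr => j _; rewrite scalerA.
by rewrite exchange_big; apply: eq_bigr => j _; rewrite mxE scaler_suml.
Qed.

Lemma indep_le r s (b : 'I_r -> V) (c : 'I_s -> V) : spans b -> indep c -> (s <= r)%N.
Proof.
move=> /(spans_matrix c) [A cE] ic.
have /eqP <- : row_free A; last exact: rank_leq_col.
rewrite -kermx_eq0; apply/eqP/row_matrixP => i; rewrite row0.
apply/rowP => j; rewrite [RHS]mxE; apply: (ic (fun j => row i (kermx A) 0 j)).
rewrite (sum_mulmx _ cE) -row_mul mulmx_ker row0 big1 // => k _.
by rewrite mxE scale0r.
Qed.

Lemma spans_min_indep r s (b : 'I_r -> V) (c : 'I_s -> V) :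
  spans b -> indep c -> spans c -> (r <= s)%N -> indep b.
Proof.
move=> sb ic sc le_rs a a0.
have [A cE] := spans_matrix c sb; have [C bE] := spans_matrix b sc.
have AC i : \sum_j (A *m C) i j *: c j = c i.
  rewrite [RHS]cE [RHS](eq_bigr (fun j => row i A 0 j *: b j)) => [|j _]; last by rewrite mxE.
  by rewrite (sum_mulmx _ bE); apply: eq_bigr => j _; rewrite -row_mul [row _ _ _ _]mxE.
have AC1 : A *m C = 1%:M.
  apply/matrixP => i j; apply: subr0_eq; move: j; apply: ic.
  rewrite (eq_bigr (fun j => (A *m C) i j *: c j - (i == j)%:R *: c j)) => [|j _]; last first.
    by rewrite -scalerBl [(1%:M : 'M_s) i j]mxE.
  rewrite sumrB AC (bigD1 i) //= eqxx scale1r big1 ?addr0 ?subrr // => j ji.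
  by rewrite eq_sym (negPf ji) scale0r.
have Cfree : row_free C.
  rewrite /row_free eqn_leq rank_leq_row /= (leq_trans le_rs) //.
  by apply: (@mulmx1_min_rank _ _ _ _ C A 1%:M); rewrite mulmx1.
have /eqP aC : (\row_i a i) *m C == 0.
  apply/eqP/rowP => j; rewrite [RHS]mxE; move: j; apply: ic.
  by rewrite -(sum_mulmx _ bE) -[RHS]a0; apply: eq_bigr => i _; rewrite mxE.
have /eqP : \row_i a i == 0 by rewrite -(mulmx_free_eq0 _ Cfree) aC.
by move=> /rowP a_0 i; have := a_0 i; rewrite !mxE.
Qed.

Lemma basis_exists r (b : 'I_r -> V) : spans b -> exists s, has_basis_of_size V s.
Proof.
move=> sb; have ex : exists s, `[< exists c : 'I_s -> V, spans c >].
  by exists r; apply/asboolP; exists b.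
case: (ex_minnP ex) => s /asboolP [c sc] s_min; exists s; apply/basisP; exists c.
split=> // a a0 i; apply/eqP/negPn/negP => ai.
case: s => [|s] in c sc s_min a a0 i ai *; first by case: i ai.
suff /s_min : `[< exists c : 'I_s -> V, spans c >] by rewrite ltnn.
apply/asboolP; exists (fun j => c (lift i j)) => v; have [e ->] := sc v.
exists (fun j => e (lift i j) - e i / a i * a (lift i j)).
rewrite (eq_bigr (fun j => e (lift i j) *: c (lift i j)
    - (e i / a i) *: (a (lift i j) *: c (lift i j)))).
  move: a0; rewrite (bigD1_ord i) //= => /eqP; rewrite addr_eq0 => /eqP a0.
  rewrite sumrB -scaler_sumr (bigD1_ord i) //= addrC; congr (_ + _).
  by rewrite -[\sum_j _]opprK -a0 scalerN opprK scalerA divfK.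
by move=> j _; rewrite scalerBl scalerA.
Qed.

End LinearAlgebra.

(** Cramer's rule, as in the proof of Nakayama's lemma: the determinant of
    diag(S) - A sends the g_i into P, and it is nonzero modulo the kernel of
    ev because A vanishes there. *)
Lemma determinant_trick (T : comNzRingType) (E : idomainType) (ev : {rmorphism T -> E})
    (V : lmodType T) (P : V -> Prop) (k : nat) (g : 'I_k -> V)
    (S : 'I_k -> T) (A : 'I_k -> 'I_k -> T) :
    submodule P -> (forall i, ev (S i) != 0) -> (forall i j, ev (A i j) = 0) ->
    (forall i, P (S i *: g i - \sum_j A i j *: g j)) ->
  exists2 t, ev t != 0 & forall i, P (t *: g i).
Proof.
move=> sP S0 A0 PA.
pose M : 'M[T]_k := \matrix_(i, j) (S i *+ (i == j) - A i j).
have PM i : P (\sum_j M i j *: g j).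
  suff -> : \sum_j M i j *: g j = S i *: g i - \sum_j A i j *: g j by [].
  rewrite (eq_bigr (fun j => (S i *+ (i == j)) *: g j - A i j *: g j)); last first.
    by move=> j _; rewrite mxE scalerBl.
  rewrite sumrB; congr (_ - _); rewrite (bigD1 i) //= eqxx big1 ?addr0 // => j ji.
  by rewrite eq_sym (negPf ji) scale0r.
exists (\det M) => [|i].
  rewrite -det_map_mx.
  have -> : map_mx ev M = diag_mx (\row_i ev (S i)).
    by apply/matrixP => i j; rewrite !mxE rmorphB rmorphMn /= A0 subr0.
  by rewrite det_diag; apply/prodf_neq0 => i _; rewrite mxE.
have -> : \det M *: g i = \sum_l (\adj M) i l *: (\sum_j M l j *: g j).
  rewrite (eq_bigr (fun l => \sum_j ((\adj M) i l * M l j) *: g j)); last first.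
    by move=> l _; rewrite scaler_sumr; apply: eq_bigr => j _; rewrite scalerA.
  rewrite exchange_big /= (eq_bigr (fun j => (\adj M *m M) i j *: g j)); last first.
    by move=> j _; rewrite -scaler_suml [(_ *m _) i j]mxE.
  rewrite mul_adj_mx (bigD1 i) //= !mxE eqxx big1 ?addr0 // => j ji.
  by rewrite !mxE eq_sym (negPf ji) scale0r.
by apply: submod_sum => // l _; apply: submodZ.
Qed.

(** * Spreading out from a point *)

Section RankVariation.
Variables (K : fieldType) (n : nat) (B : comAlgType K).
Local Notation Kx := {mpoly K[n]}.
Local Notation T := {mpoly B[n]}.
Local Notation L := (ratfun K n).
Definition base_poly : {rmorphism Kx -> T} := map_mpoly (in_alg B).

Implicit Types (eps : {rmorphism B -> K}) (V : lmodType L).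

Definition ev eps : {rmorphism T -> Kx} := map_mpoly eps.

Lemma evC eps b : ev eps b%:MP = (eps b)%:MP.
Proof. exact: map_mpolyC. Qed.

Definition algebra_map eps : Prop := forall c : K, eps c%:A = c.

Lemma ev_base eps e : algebra_map eps -> ev eps (base_poly e) = e.
Proof.
move=> epsK; apply/mpolyP => m.
by rewrite /ev /= !mcoeff_map_mpoly /= epsK.
Qed.

Variable N : lmodType T.

(** V is the fibre of N at the point eps, through the quotient map Phi: an
    L-vector space because the nonzero elements of K[x] act invertibly. *)
Record fibre_model eps (V : lmodType L) (Phi : N -> V) : Prop := {
  fm_add : {morph Phi : u v / u + v};
  fm_surj : forall v, exists u, Phi u = v;
  fm_equiv : forall t u, Phi (t *: u) = tofrac (ev eps t) *: Phi u;
  fm_ker : forall u, Phi u = 0 -> exists (k : nat) (z : 'I_k -> B) (w : 'I_k -> N),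
    (forall i, eps (z i) = 0) /\ u = \sum_i (z i)%:MP *: w i }.

Lemma fm_sum eps V (Phi : N -> V) (I : finType) (F : I -> N) :
  fibre_model eps Phi -> Phi (\sum_i F i) = \sum_i Phi (F i).
Proof.
move=> fm; apply: (big_morph _ (fm_add fm)).
by apply: (addIr (Phi 0)); rewrite -(fm_add fm) !add0r.
Qed.

Lemma fm_lincomb eps V (Phi : N -> V) (r : nat) (c : 'I_r -> T) (g : 'I_r -> N) :
    fibre_model eps Phi ->
  Phi (\sum_i c i *: g i) = \sum_i tofrac (ev eps (c i)) *: Phi (g i).
Proof.
by move=> fm; rewrite (fm_sum _ fm); apply: eq_bigr => i _; rewrite (fm_equiv fm).
Qed.

Definition lincombs r (g : 'I_r -> N) (v : N) : Prop :=
  exists c : 'I_r -> T, v = \sum_i c i *: g i.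

Lemma lincombs_submod r (g : 'I_r -> N) : submodule (lincombs g).
Proof.
split=> [|a _ _ [c ->] [c' ->]].
  by exists (fun=> 0); rewrite big1 // => i _; rewrite scale0r.
exists (fun i => a * c i + c' i); rewrite scaler_sumr -big_split /=.
by apply: eq_bigr => i _; rewrite scalerDl scalerA.
Qed.

(* N is a finitely generated module over the localization of B[x] at the
   nonzero elements of K[x]. *)
Variables (k0 : nat) (g0 : 'I_k0 -> N).
Hypothesis g0_gen : forall v, exists2 e : Kx, e != 0 & lincombs g0 (base_poly e *: v).
Hypothesis Kx_inj : forall (e : Kx) (v : N), e != 0 -> base_poly e *: v = 0 -> v = 0.
Hypothesis Kx_div : forall (e : Kx) (v : N), e != 0 -> exists u, base_poly e *: u = v.

Lemma fibre_spans eps V (Phi : N -> V) (r : nat) (g : 'I_r -> N) (s : T) :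
    algebra_map eps -> fibre_model eps Phi -> ev eps s != 0 ->
    (forall v, exists2 e : Kx, e != 0 & lincombs g (base_poly e *: (s *: v))) ->
  spans (Phi \o g).
Proof.
move=> epsK fm s0 gen v; have [u <-] := fm_surj fm v.
have [e e0 [c cE]] := gen u.
have es0 : tofrac (e * ev eps s) != 0 by rewrite tofrac_eq0 mulf_neq0.
exists (fun i => (tofrac (e * ev eps s))^-1 * tofrac (ev eps (c i))).
rewrite (eq_bigr (fun i => (tofrac (e * ev eps s))^-1 *: (tofrac (ev eps (c i)) *: Phi (g i)))).
  rewrite -scaler_sumr -(fm_lincomb _ _ fm) -cE scalerA (fm_equiv fm).
  by rewrite (rmorphM (ev eps)) ev_base // scalerA mulVf // scale1r.
by move=> i _; rewrite scalerA.
Qed.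

Lemma fibre_generators eps V (Phi : N -> V) :
  algebra_map eps -> fibre_model eps Phi -> spans (Phi \o g0).
Proof.
move=> epsK fm; apply: (fibre_spans (s := 1) epsK fm); first by rewrite rmorph1 oner_neq0.
by move=> v; rewrite scale1r.
Qed.

Lemma common_lincombs (I : finType) r (g : 'I_r -> N) (s : T) (u : I -> N) :
    (forall v, exists2 e : Kx, e != 0 & lincombs g (base_poly e *: (s *: v))) ->
  exists2 e : Kx, e != 0 & exists C : I -> 'I_r -> T,
    forall i, (base_poly e * s) *: u i = \sum_j C i j *: g j.
Proof.
move=> gen.
have [i e f He|i|e e0 He] :=
    @common_multiple Kx I (fun i e => lincombs g ((base_poly e * s) *: u i)).
- by rewrite rmorphM -mulrA -scalerA; apply: (submodZ _ (lincombs_submod g)) He.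
- by have [e e0 He] := gen (u i); exists e; rewrite // -scalerA.
by have [C CP] := choice He; exists e => //; exists C.
Qed.

(** Nakayama's lemma: lifts of a spanning family of the fibre generate N after
    inverting some s that does not vanish at eps. *)
Lemma spans_spread eps V (Phi : N -> V) (r : nat) (g : 'I_r -> N) :
    algebra_map eps -> fibre_model eps Phi -> spans (Phi \o g) ->
  exists2 s, ev eps s != 0 &
    forall v, exists2 e : Kx, e != 0 & lincombs g (base_poly e *: (s *: v)).
Proof.
move=> epsK fm sg.
have /choice [S SP] (i : 'I_k0) : exists SA : Kx * ('I_k0 -> T),
    [/\ SA.1 != 0, forall j, ev eps (SA.2 j) = 0 &
        lincombs g (base_poly SA.1 *: g0 i - \sum_j SA.2 j *: g0 j)].
  have [a aE] := sg (Phi (g0 i)).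
  have [e1 e10 [c cE]] := common_den a.
  have Phi0 : Phi (base_poly e1 *: g0 i + \sum_j (- base_poly (c j)) *: g j) = 0.
    rewrite (fm_add fm) (fm_equiv fm) (fm_lincomb _ _ fm) ev_base // aE scaler_sumr.
    rewrite -big_split big1 // => j _; rewrite rmorphN /= ev_base // scalerA cE.
    by rewrite rmorphN scaleNr subrr.
  have [k [z [u [z0 uE]]]] := fm_ker fm Phi0.
  have [v|e2 e20 [C CE]] := @common_lincombs _ _ g0 1 u.
    by rewrite scale1r; apply: g0_gen.
  exists (e2 * e1, fun j => \sum_l (z l)%:MP * C l j); split=> /= [|j|].
  - exact: mulf_neq0.
  - rewrite rmorph_sum big1 // => l _.
    by rewrite rmorphM evC z0 mpolyC0 mul0r.
  exists (fun j => base_poly e2 * base_poly (c j)).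
  have -> : \sum_j (\sum_l (z l)%:MP * C l j) *: g0 j =
      base_poly e2 *: (base_poly e1 *: g0 i + \sum_j (- base_poly (c j)) *: g j).
    rewrite uE scaler_sumr (eq_bigr (fun j => \sum_l (z l)%:MP *: (C l j *: g0 j))).
      rewrite exchange_big /=; apply: eq_bigr => l _.
      by rewrite -scaler_sumr -CE mulr1 !scalerA mulrC.
    by move=> j _; rewrite scaler_suml; apply: eq_bigr => l _; rewrite scalerA.
  rewrite scalerDr rmorphM -scalerA opprD addrA subrr sub0r -scalerN -sumrN scaler_sumr.
  by apply: eq_bigr => j _; rewrite scaleNr opprK scalerA.
have [||||s s0 sP] := @determinant_trick _ _ (ev eps) N (lincombs g) k0 g0
    (fun i => base_poly (S i).1) (fun i j => (S i).2 j).
- exact: lincombs_submod.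
- by move=> i; rewrite ev_base //; case: (SP i).
- by move=> i j; case: (SP i).
- by move=> i; case: (SP i).
exists s => // v; have [e e0 [c cE]] := g0_gen v; exists e => //.
rewrite scalerA mulrC -scalerA cE scaler_sumr; apply: (submod_sum (lincombs_submod g)) => i _.
by rewrite scalerA mulrC -scalerA; apply: (submodZ _ (lincombs_submod g)).
Qed.

Section AtPoint.
Variables (eps0 : {rmorphism B -> K}) (d : nat) (y : 'I_d -> B).
Hypothesis eps0K : algebra_map eps0.
Hypothesis y_ideal : forall b, eps0 b = 0 <-> in_span y predT b.

Let Y (j : 'I_d) : T := (y j)%:MP.

Lemma ev_eq0_span p : ev eps0 p = 0 -> exists f : 'I_d -> T, p = \sum_j Y j * f j.
Proof.
move=> p0; have /choice [c cE] m : exists c : 'I_d -> B, p@_m = \sum_j c j * y j.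
  by apply/y_ideal; have := congr1 (mcoeff m) p0; rewrite mcoeff_map_mpoly mcoeff0.
exists (fun j => \sum_(m <- msupp p) c m j *: 'X_[m]).
rewrite {1}(mpolyE p) (eq_bigr (fun j => \sum_(m <- msupp p) (c m j * y j) *: 'X_[m])).
  by rewrite exchange_big; apply: eq_bigr => m _; rewrite cE scaler_suml.
move=> j _; rewrite mulr_sumr; apply: eq_bigr => m _.
by rewrite mul_mpolyC scalerA mulrC.
Qed.

Lemma ev_Y j : ev eps0 (Y j) = 0.
Proof.
rewrite evC; have -> : eps0 (y j) = 0; last exact: mpolyC0.
apply/y_ideal; exists (fun i => (i == j)%:R).
by rewrite (bigD1 j) //= eqxx mul1r big1 ?addr0 // => i /negPf ->; rewrite mul0r.
Qed.

(* the fibre at the point cut out by y, and lifts g of a spanning family of it *)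
Variables (V0 : lmodType L) (Phi0 : N -> V0) (r : nat) (g : 'I_r -> N).
Hypothesis fm0 : fibre_model eps0 Phi0.
Hypothesis g_spans : spans (Phi0 \o g).

Local Notation F := {ffun 'I_r -> T^o}.

Definition comb (q : F) : N := \sum_i (q i : T) *: g i.

Lemma combD : {morph comb : p q / p + q}.
Proof.
move=> p q; rewrite /comb -big_split; apply: eq_bigr => i _.
by rewrite ffunE scalerDl.
Qed.

Lemma combZ a q : comb (a *: q) = a *: comb q.
Proof.
by rewrite /comb scaler_sumr; apply: eq_bigr => i _; rewrite ffunE scalerA.
Qed.

Lemma comb_sum (I : finType) (P : pred I) (G : I -> F) :
  comb (\sum_(i | P i) G i) = \sum_(i | P i) comb (G i).
Proof.
apply: (big_morph _ combD); apply: (addIr (comb 0)).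
by rewrite -combD !add0r.
Qed.

Lemma comb_submod : submodule (fun q : F => comb q = 0).
Proof.
split=> [|a p q p0 q0]; last by rewrite combD combZ p0 q0 scaler0 addr0.
by apply: (addIr (comb 0)); rewrite -combD !add0r.
Qed.

Lemma comb_diff (w : koszul_chain d F) :
  koszul_diff Y ([ffun J => comb (w J)] : koszul_chain d N) =
    [ffun J => comb (koszul_diff Y w J)].
Proof. exact: (kdiff_map (phi := idfun) Y w combD combZ). Qed.

Lemma diff_scale (M : lmodType T) (a : T) (w : koszul_chain d M) :
  koszul_diff Y ([ffun J => a *: w J] : koszul_chain d M) =
    [ffun J => a *: koszul_diff Y w J].
Proof.
apply: (kdiff_map (phi := idfun) Y w) => [u v|b v]; first exact: scalerDr.
by rewrite !scalerA mulrC.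
Qed.

(** If the lifts g_i of a basis of the fibre at eps0 satisfy only relations
    killed by some t with t(eps0) nonzero, they stay independent in the fibres
    at all points where t does not vanish.  Vanishing of the first Koszul
    homology gives such a t: for a relation q, the q_i vanish at eps0, say
    q = sum_j y_j f_j; then the elements sum_i f_ji g_i are a syzygy of y on N,
    hence trivial, and correcting the f_j accordingly shows that the module of
    relations Q satisfies Q = yQ at eps0. *)
Lemma indep_spread :
    noetherian_mod T^o -> indep (Phi0 \o g) -> ~ koszul_homology_neq0 Y N 1 ->
  exists2 t : T, ev eps0 t != 0 &
    forall eps V (Phi : N -> V), algebra_map eps -> fibre_model eps Phi ->
      ev eps t != 0 -> indep (Phi \o g).
Proof.
move=> noeT ig H1; have [s s0 gen] := spans_spread eps0K fm0 g_spans.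
have relation_split (q : F) : comb q = 0 -> exists2 e : Kx, e != 0 &
    exists f : 'I_d -> F, (forall j, comb (f j) = 0) /\
      (base_poly e * s) *: q = \sum_j Y j *: f j.
  move=> q0.
  have /choice [f fE] i : exists f : 'I_d -> T, (q i : T) = \sum_j Y j * f j.
    apply: ev_eq0_span; apply/eqP; rewrite -tofrac_eq0; apply/eqP; move: i.
    apply: ig; rewrite -(fm_lincomb _ _ fm0) -[X in Phi0 X]/(comb q) q0.
    by rewrite -(scale0r 0) (fm_equiv fm0) rmorph0 tofrac0 scale0r.
  pose fj j : F := [ffun i => f i j].
  have qE : q = \sum_j Y j *: fj j.
    apply/ffunP => i; rewrite sum_ffunE fE; apply: eq_bigr => j _.
    by rewrite !ffunE.
  pose w : koszul_chain d N := [ffun J : {set 'I_d} => \sum_(j | J == [set j]) comb (fj j)].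
  have w1 j : w [set j] = comb (fj j).
    by rewrite ffunE (big_pred1 j) // => l; rewrite (inj_eq set1_inj) eq_sym.
  have wE (J : {set 'I_d}) : #|J| <> 1%N -> w J = 0.
    move=> J1; rewrite ffunE big_pred0 // => j; apply/eqP => JE.
    by apply: J1; rewrite JE cards1.
  have cw : koszul_diff Y w = 0.
    apply/ffunP => J; rewrite [RHS]ffunE; have [->|J0] := eqVneq J set0.
      rewrite kdiff_set0 (eq_bigr (fun j => comb (Y j *: fj j))) => [|j _].
        by rewrite -comb_sum -qE.
      by rewrite w1 combZ.
    rewrite kdiffE big1 // => j jJ; rewrite wE ?scaler0 //.
    by rewrite cardsU1 jJ add1n => - [] /eqP; rewrite cards_eq0 (negPf J0).
  have [w' dw' w'E] : exists2 w' : koszul_chain d N, koszul_deg 2 w' & koszul_diff Y w' = w.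
    apply: contrapT => nw; apply: H1; exists w; split=> // w' dw' w'E.
    by apply: nw; exists w'.
  have [e e0 [C CE]] := common_lincombs w' gen.
  pose W : koszul_chain d F := [ffun J : {set 'I_d} => [ffun i => C J i] : F].
  have WE J : comb (W J) = (base_poly e * s) *: w' J.
    by rewrite CE /comb; apply: eq_bigr => i _; rewrite !ffunE.
  (* subtracting the lifted boundary moves e s f_j into Q without changing
     its combination with y *)
  exists e => //; exists (fun j => (base_poly e * s) *: fj j - koszul_diff Y W [set j]).
  split=> [j|].
    have := congr1 (fun v : koszul_chain d N => v [set j]) (comb_diff W).
    rewrite [RHS]ffunE.
    have -> : ([ffun J => comb (W J)] : koszul_chain d N) = [ffun J => (base_poly e * s) *: w' J].
      by apply/ffunP => J; rewrite ffunE [RHS]ffunE WE.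
    rewrite diff_scale [LHS]ffunE w'E w1 => E.
    by rewrite -scaleN1r addrC combD !combZ -E scaleN1r addNr.
  rewrite (eq_bigr (fun j => (base_poly e * s) *: (Y j *: fj j) - Y j *: koszul_diff Y W [set j])).
    rewrite sumrB -scaler_sumr -qE.
    have dW := kdiff_syzygy Y W.
    by rewrite dW subr0.
  by move=> j _; rewrite scalerBr !scalerA mulrC.
have [gs [gs0 gs_span]] := noetherian_free noeT comb_submod.
pose h (i : 'I_(size gs)) : F := gs`_i.
have h0 i : comb (h i) = 0 by apply: gs0; apply: mem_nth.
have /choice [A AP] (i : 'I_(size gs)) : exists SA : Kx * ('I_(size gs) -> T),
    [/\ SA.1 != 0, forall j, ev eps0 (SA.2 j) = 0 &
        (base_poly SA.1 * s) *: h i - \sum_j SA.2 j *: h j = 0].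
  have [e e0 [f [f0 fE]]] := relation_split _ (h0 i).
  have [c cE] := choice (fun j => spanP (gs_span _ (f0 j))).
  exists (e, fun k : 'I_(size gs) => \sum_j Y j * c j k); split=> //= [k|].
    by rewrite rmorph_sum big1 // => j _; rewrite rmorphM ev_Y mul0r.
  rewrite fE; apply/eqP; rewrite subr_eq0; apply/eqP.
  rewrite (eq_bigr (fun j => \sum_(k < size gs) (Y j * c j k) *: h k)) => [|j _].
    by rewrite exchange_big; apply: eq_bigr => k _; rewrite scaler_suml.
  by rewrite cE scaler_sumr; apply: eq_bigr => k _; rewrite scalerA.
have [||||t t0 tP] := @determinant_trick _ _ (ev eps0) F (fun v => v = 0) _ h
    (fun i => base_poly (A i).1 * s) (fun i j => (A i).2 j).
- by split=> // a u v -> ->; rewrite scaler0 addr0.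
- by move=> i; rewrite rmorphM ev_base // mulf_neq0 //; case: (AP i).
- by move=> i j; case: (AP i).
- by move=> i; case: (AP i).
have tQ (q : F) : comb q = 0 -> t *: q = 0.
  move=> /gs_span /spanP [c ->]; rewrite scaler_sumr big1 // => i _.
  by rewrite scalerA mulrC -scalerA (tP i) scaler0.
exists (t * s) => [|eps V Phi epsK fm ts0 a a0 i]; first by rewrite rmorphM mulf_neq0.
have [e e0 [c cE]] := common_den a.
have Phic : Phi (\sum_i base_poly (c i) *: g i) = 0.
  rewrite (fm_lincomb _ _ fm) (eq_bigr (fun i => tofrac e *: (a i *: Phi (g i)))).
    by rewrite -scaler_sumr a0 scaler0.
  by move=> j _; rewrite ev_base // -cE scalerA.
have [k [z [u [z0 uE]]]] := fm_ker fm Phic.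
have [e' e'0 [C CE]] := common_lincombs u gen.
pose q : F := [ffun i => base_poly e' * s * base_poly (c i) - \sum_l (z l)%:MP * C l i].
have q0 : comb q = 0.
  rewrite /comb (eq_bigr (fun i => (base_poly e' * s) *: (base_poly (c i) *: g i)
      - \sum_l (z l)%:MP *: (C l i *: g i))) => [|j _].
    rewrite sumrB -scaler_sumr uE exchange_big scaler_sumr -sumrB big1 // => l _.
    by rewrite -scaler_sumr -CE !scalerA mulrC subrr.
  rewrite ffunE scalerBl scalerA scaler_suml; congr (_ - _).
  by apply: eq_bigr => l _; rewrite scalerA.
have := congr1 (fun v : F => ev eps (v i : T)) (tQ q q0).
rewrite !ffunE rmorph0 => /eqP; rewrite -[t *: _]/(t * _).
rewrite rmorphM rmorphB rmorph_sum big1; last first.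
  by move=> l _; rewrite rmorphM evC z0 mpolyC0 mul0r.
rewrite subr0 2!rmorphM !ev_base // !mulf_eq0 (negPf e'0) /=.
move: ts0; rewrite rmorphM mulf_eq0 negb_or => /andP [/negPf -> /negPf ->] /= ci0.
apply/eqP; have := congr1 (fun x => x == 0) (cE i); rewrite (eqP ci0) rmorph0 eqxx.
by rewrite mulf_eq0 tofrac_eq0 (negPf e0).
Qed.

(** Coefficientwise, the Koszul complex of y on B[x] is a sum of copies of the
    one on B. *)
Lemma regular_koszul_mpoly i (w : koszul_chain d T^o) :
    regular_sequence y -> koszul_deg i.+1 w -> koszul_diff Y w = 0 ->
  exists w' : koszul_chain d T^o, koszul_deg i.+2 w' /\ koszul_diff Y w' = w.
Proof.
move=> y_reg dw cw.
pose cf (m : 'X_{1..n}) (v : koszul_chain d T^o) : koszul_chain d B^o :=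
  [ffun J => (v J : T)@_m].
have cf_diff m v : koszul_diff y (cf m v) = cf m (koszul_diff Y v).
  apply/ffunP => J; rewrite [RHS]ffunE !kdiffE raddf_sum; apply: eq_bigr => k _.
  rewrite ffunE -[_ *: v _]/(_ * _).
  have -> : ksign T J k = (ksign B J k)%:MP by rewrite /ksign rmorphXn rmorphN1.
  by rewrite -mpolyCM /= mcoeffCM.
have /choice [u uP] m : exists u : koszul_chain d B^o,
    koszul_deg i.+2 u /\ koszul_diff y u = cf m w.
  apply: (regular_koszul_acyclic y_reg) => [J Ji|]; first by rewrite ffunE dw // mcoeff0.
  by rewrite cf_diff cw; apply/ffunP => J; rewrite !ffunE mcoeff0.
pose ms := undup (flatten [seq msupp (w J : T) | J <- enum {set 'I_d}]).
pose w' : koszul_chain d T^o :=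
  [ffun J : {set 'I_d} => \sum_(m <- ms) (u m J : B) *: 'X_[m] : T].
have w'E m J : (w' J : T)@_m = if m \in ms then u m J else 0.
  rewrite ffunE raddf_sum /=; case: ifP => mm.
    rewrite (bigD1_seq m) ?undup_uniq //= mcoeffZ mcoeffX eqxx mulr1 big1 ?addr0 // => m' mm'.
    by rewrite mcoeffZ mcoeffX (negPf mm') mulr0.
  rewrite big_seq big1 // => m' m'm; rewrite mcoeffZ mcoeffX.
  by case: eqP m'm => [->|]; rewrite ?mm ?mulr0.
exists w'; split=> [J Ji|].
  by apply/mpolyP => m; rewrite w'E mcoeff0 (uP m).1 //; case: ifP.
apply/ffunP => J; apply/mpolyP => m.
have := congr1 (fun v : koszul_chain d B^o => v J) (cf_diff m w').
rewrite [RHS]ffunE => <-; have [mm|mm] := boolP (m \in ms).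
  have -> : cf m w' = u m by apply/ffunP => J'; rewrite ffunE w'E mm.
  by rewrite (uP m).2 ffunE.
rewrite kdiffE big1 => [|k _]; last by rewrite ffunE w'E (negPf mm) scaler0.
apply/esym/memN_msupp_eq0; apply: contra mm => mJ; rewrite mem_undup.
by apply/flattenP; exists (msupp (w J : T)) => //; apply: map_f; rewrite mem_enum.
Qed.

(** If the g_i are independent in the fibres near eps0, a relation among them
    has coefficients vanishing at all points near eps0, so by the
    Nullstellensatz it is killed by some sigma with sigma(eps0) nonzero.  Then
    sigma times a Koszul cycle of N lifts to a Koszul cycle of a free module,
    which is a boundary since y is regular; as y annihilates the homology,
    sigma acts on it through its value in K(x) at eps0, that is, invertibly. *)
Lemma koszul_vanishing (b : B) i :
    regular_sequence y -> eps0 b != 0 ->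
    (forall z : B, (forall eps, algebra_map eps -> eps z = 0) -> z = 0) ->
    (forall eps, algebra_map eps -> eps b != 0 ->
       exists (V : lmodType L) (Phi : N -> V), fibre_model eps Phi /\
         (spans (Phi \o g) -> indep (Phi \o g))) ->
  ~ koszul_homology_neq0 Y N i.+1.
Proof.
move=> y_reg b0 null near_indep [w [dw cw w_nb]].
have [s s0 gen] := spans_spread eps0K fm0 g_spans.
pose sigma : T := b%:MP * s.
have sigmaQ (q : F) : comb q = 0 -> forall j, sigma * (q j : T) = 0.
  move=> q0 j; apply/mpolyP => m; rewrite mcoeff0; apply: null => eps epsK.
  suff : ev eps (sigma * (q j : T)) = 0.
    by move/(congr1 (mcoeff m)); rewrite mcoeff_map_mpoly mcoeff0.
  rewrite 2!rmorphM evC.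
  have [->|epsb] := eqVneq (eps b) 0; first by rewrite mpolyC0 !mul0r.
  have [->|epss] := eqVneq (ev eps s) 0; first by rewrite mulr0 mul0r.
  have [V [Phi [fm ig]]] := near_indep eps epsK epsb.
  have {}ig := ig (fibre_spans epsK fm epss gen).
  have /eqP : tofrac (ev eps (q j : T)) = 0.
    move: j; apply: ig; rewrite -(fm_lincomb _ _ fm) -[X in Phi X]/(comb q) q0.
    by rewrite -(scale0r 0) (fm_equiv fm) rmorph0 tofrac0 scale0r.
  by rewrite tofrac_eq0 => /eqP ->; rewrite mulr0.
have [e e0 [C CE]] := common_lincombs w gen.
pose W : koszul_chain d F :=
  [ffun J : {set 'I_d} => if #|J| == i.+1 then [ffun j => C J j] : F else 0].
have comb0 : comb 0 = 0 := comb_submod.1.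
have WE J : comb (W J) = (base_poly e * s) *: w J.
  rewrite ffunE; case: eqP => [_|Ji]; last by rewrite dw // scaler0.
  by rewrite CE /comb; apply: eq_bigr => j _; rewrite ffunE.
have dWQ J : comb (koszul_diff Y W J) = 0.
  have := congr1 (fun v : koszul_chain d N => v J) (comb_diff W).
  rewrite [RHS]ffunE => <-.
  have -> : ([ffun J => comb (W J)] : koszul_chain d N) = [ffun J => (base_poly e * s) *: w J].
    by apply/ffunP => J'; rewrite ffunE [RHS]ffunE WE.
  by rewrite diff_scale ffunE cw ffunE scaler0.
pose Wj (j : 'I_r) : koszul_chain d T^o := [ffun J : {set 'I_d} => sigma * (W J j : T)].
have dWj j J : koszul_diff Y (Wj j) J = sigma * (koszul_diff Y W J j : T).
  rewrite !kdiffE sum_ffunE mulr_sumr; apply: eq_bigr => k _.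
  by rewrite !ffunE /GRing.scale /= mulrCA.
have /choice [U UP] j : exists u : koszul_chain d T^o,
    koszul_deg i.+2 u /\ koszul_diff Y u = Wj j.
  apply: regular_koszul_mpoly => // [J /eqP Ji|].
    by rewrite ffunE [W J]ffunE (negPf Ji) ffunE mulr0.
  by apply/ffunP => J; rewrite dWj sigmaQ // ffunE.
(* tau w is the boundary of u1, and so are the multiples of w by the kernel
   of ev eps0, to which tau - c belongs *)
pose tau : T := sigma * (base_poly e * s).
pose u1 : koszul_chain d N := [ffun J : {set 'I_d} => \sum_j (U j J : T) *: g j].
have du1 : koszul_deg i.+2 u1.
  by move=> J Ji; rewrite ffunE big1 // => j _; rewrite (UP j).1 // scale0r.
have cu1 J : koszul_diff Y u1 J = tau *: w J.
  rewrite kdiffE (eq_bigr (fun k : 'I_d =>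
    \sum_j ((ksign T J k * Y k) * (U j (k |: J) : T)) *: g j)).
    rewrite exchange_big /= -scalerA -WE /comb scaler_sumr; apply: eq_bigr => j _.
    rewrite -scaler_suml scalerA; congr (_ *: _).
    have := congr1 (fun v : koszul_chain d T^o => v J) (UP j).2.
    by rewrite kdiffE [RHS]ffunE.
  by move=> k _; rewrite ffunE scaler_sumr; apply: eq_bigr => j _; rewrite scalerA.
pose c : Kx := ev eps0 tau.
have c0 : c != 0.
  rewrite /c /tau /sigma !rmorphM evC ev_base // !mulf_neq0 //.
  by rewrite mpolyC_eq0.
have [h hE] : exists h : 'I_d -> T, tau - base_poly c = \sum_j Y j * h j.
  by apply: ev_eq0_span; rewrite rmorphB ev_base // subrr.
have /choice [v vP] j := koszul_homotopy j dw cw.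
pose u2 : koszul_chain d N := [ffun J : {set 'I_d} => u1 J - \sum_j h j *: v j J].
have du2 : koszul_deg i.+2 u2.
  move=> J Ji; rewrite ffunE du1 // big1 ?subr0 // => j _.
  by rewrite (vP j).1 // scaler0.
have cu2 J : koszul_diff Y u2 J = base_poly c *: w J.
  have -> : base_poly c = tau - \sum_j Y j * h j by rewrite -hE opprB addrC subrK.
  rewrite scalerBl -cu1 scaler_suml.
  rewrite (eq_bigr (fun j => h j *: koszul_diff Y (v j) J)) => [|j _]; last first.
    by rewrite (vP j).2 scalerA mulrC.
  rewrite !kdiffE (eq_bigr (fun k : 'I_d => (ksign T J k * Y k) *: u1 (k |: J)
      - \sum_j h j *: ((ksign T J k * Y k) *: v j (k |: J)))) => [|k _].
    rewrite sumrB exchange_big; congr (_ - _); apply: eq_bigr => j _.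
    by rewrite kdiffE scaler_sumr.
  rewrite ffunE scalerBr scaler_sumr; congr (_ - _); apply: eq_bigr => j _.
  by rewrite !scalerA mulrC.
have /choice [u3 u3E] J := Kx_div (u2 J) c0.
apply: (w_nb [ffun J => u3 J]) => [J Ji|].
  by rewrite ffunE; apply: (Kx_inj c0); rewrite u3E du2.
apply/ffunP => J; apply/eqP; rewrite -subr_eq0; apply/eqP; apply: (Kx_inj c0).
rewrite scalerBr -cu2; apply/eqP; rewrite subr_eq0; apply/eqP.
have := congr1 (fun v : koszul_chain d N => v J)
  (diff_scale (base_poly c) ([ffun J => u3 J] : koszul_chain d N)).
rewrite [RHS]ffunE => <-; congr (koszul_diff Y _ J).
by apply/ffunP => J'; rewrite ffunE ffunE u3E.
Qed.

End AtPoint.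
End RankVariation.

(** * Polynomials acting on the rank module *)

Lemma mpoly_ring_ind (R : nzRingType) (n : nat) (P : {mpoly R[n]} -> Prop) :
    (forall c, P c%:MP) -> (forall i, P 'X_i) ->
    (forall p q, P p -> P q -> P (p + q)) -> (forall p q, P p -> P q -> P (p * q)) ->
  forall p, P p.
Proof.
move=> PC PX PD PM p; have P0 : P 0 by rewrite -mpolyC0.
rewrite (mpolyE p); apply: (big_ind P) => // m _.
rewrite -mul_mpolyC; apply: (PM) => //; rewrite mpolyXE_id.
have P1 : P 1 by rewrite -mpolyC1.
apply: (big_ind P P1 PM) => i _.
by elim: (m i) => [|k IHk]; rewrite ?expr0 // exprS; apply: PM.
Qed.

Lemma koszul_homology_transfer (T T' : comPzRingType) (d : nat) (y : 'I_d -> T)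
    (phi : {rmorphism T -> T'}) (N : lmodType T) (N' : lmodType T') (f : N -> N')
    (f' : N' -> N) (i : nat) :
    {morph f : u v / u + v} -> (forall a v, f (a *: v) = phi a *: f v) ->
    cancel f f' -> cancel f' f ->
  koszul_homology_neq0 y N i <-> koszul_homology_neq0 (phi \o y) N' i.
Proof.
move=> fD fZ fK f'K.
have f0 : f 0 = 0 by apply: (addIr (f 0)); rewrite -fD !add0r.
have f'0 : f' 0 = 0 by rewrite -f0 fK.
have dmap w := kdiff_map (phi := phi) y w fD fZ.
pose F (w : koszul_chain d N) : koszul_chain d N' := [ffun J => f (w J)].
pose F' (w : koszul_chain d N') : koszul_chain d N := [ffun J => f' (w J)].
have FK : cancel F F' by move=> w; apply/ffunP => J; rewrite !ffunE fK.
have F'K : cancel F' F by move=> w; apply/ffunP => J; rewrite !ffunE f'K.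
have F0 : F 0 = 0 by apply/ffunP => J; rewrite !ffunE f0.
have dF w : koszul_diff (phi \o y) (F w) = F (koszul_diff y w) := dmap w.
have Fdeg k w : koszul_deg k (F w) <-> koszul_deg k w.
  split=> dw J Jk; last by rewrite ffunE dw.
  by apply: (can_inj fK); have := dw J Jk; rewrite ffunE f0.
split=> [[w [dw cw nw]]|[w [dw cw nw]]].
  exists (F w); split; [exact/Fdeg | by rewrite dF cw F0|] => w' dw' E.
  apply: (nw (F' w')); first by apply/Fdeg; rewrite F'K.
  by apply: (can_inj FK); rewrite -dF F'K.
exists (F' w); split; first by apply/Fdeg; rewrite F'K.
  by apply: (can_inj FK); rewrite -dF F'K cw F0.
move=> w' dw' E; apply: (nw (F w')); first exact/Fdeg.
by rewrite dF E F'K.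
Qed.

Lemma pres_ring_comm (G : Type) (rel : rexpr G -> rexpr G -> Prop) :
    (forall g h, GRing.comm (pres_gen rel g) (pres_gen rel h)) ->
  forall a b : pres_ring rel, GRing.comm a b.
Proof.
move=> gen_comm.
have comm_ind (a : pres_ring rel) : (forall g, GRing.comm a (pres_gen rel g)) ->
    forall b, GRing.comm a b.
  move=> ga b; rewrite -[b]pres_repK; elim: (pres_rep b) => [g|||u IHu|u IHu v IHv|u IHu v IHv].
  - exact: ga.
  - by rewrite pres_clsE /GRing.comm mulr0 mul0r.
  - by rewrite pres_clsE; apply: commr1.
  - by rewrite pres_clsE; apply: commrN.
  - by rewrite pres_clsE; apply: commrD.
  - by rewrite pres_clsE; apply: commrM.
by move=> a; apply: (comm_ind) => g; apply: commr_sym; apply: comm_ind.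
Qed.

Section GlobalSections.
Variables (K : fieldType) (n : nat) (B : comAlgType K).
Local Notation Kx := {mpoly K[n]}.
Local Notation T := {mpoly B[n]}.
Local Notation L := (ratfun K n).
Local Notation S := (coord_ratfun n B).
Local Notation sl := (tensl (in_alg B) (poly_ratfun K n \o @mpolyC n K)).
Local Notation sr := (tensr (in_alg B) (poly_ratfun K n \o @mpolyC n K)).

Lemma coord_ratfun_comm (a b : S) : a * b = b * a.
Proof.
apply: (@pres_ring_comm _ (tens_rel (in_alg B) (poly_ratfun K n \o @mpolyC n K))).
move=> [b1|s1] [b2|s2].
- rewrite /GRing.comm -[pres_gen _ (TL _ b1)]/(sl b1) -[pres_gen _ (TL _ b2)]/(sl b2).
  by rewrite -!rmorphM mulrC.
- exact: tenslr_comm.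
- by apply: commr_sym; apply: tenslr_comm.
- rewrite /GRing.comm -[pres_gen _ (TR _ s1)]/(sr s1) -[pres_gen _ (TR _ s2)]/(sr s2).
  by rewrite -!rmorphM mulrC.
Qed.

Variable eps0 : {rmorphism B -> K}.
Hypothesis eps0K : algebra_map eps0.

(** Evaluation at eps0 makes K(x) a nonzero module over B (x) K(x). *)
Lemma coord_ratfun_nontrivial : (1 : S) != 0.
Proof.
pose rho (g : tens_gen B L) (v : L) : L :=
  match g with TL b => tofrac (eps0 b)%:MP * v | TR s => s * v end.
have rhoD g : {morph rho g : v w / v + w} by case: g => [b|s] v w /=; rewrite mulrDr.
have rho_rel u w : tens_rel (in_alg B) (poly_ratfun K n \o @mpolyC n K) u w ->
    reval rho u =1 reval rho w.
  case=> [|a b|a b||a b|a b|a b|c] v /=.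
  - by rewrite rmorph1 mpolyC1 rmorph1 mul1r.
  - by rewrite rmorphD mpolyCD rmorphD mulrDl.
  - by rewrite rmorphM mpolyCM rmorphM mulrA.
  - by rewrite mul1r.
  - by rewrite mulrDl.
  - by rewrite mulrA.
  - by rewrite mulrCA.
  - by rewrite eps0K.
apply/eqP => /(congr1 (fun a => pres_act rho a 1)).
rewrite -pres_clsOne -pres_clsZero !(pres_actE rhoD rho_rel) /=.
by move/eqP; rewrite oner_eq0.
Qed.

Definition coord_nz : nzRingType :=
  HB.pack (tensalg (in_alg B) (poly_ratfun K n \o @mpolyC n K))
    (GRing.PzSemiRing_isNonZero.Build S coord_ratfun_nontrivial).

Definition coordl : {rmorphism B -> coord_nz} := sl.

Definition coord_mpoly_fun : T -> coord_nz :=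
  mmap coordl (fun i => sr (poly_ratfun K n 'X_i)).

Lemma coord_mpoly_zmod : zmod_morphism coord_mpoly_fun.
Proof. by move=> p q; rewrite /coord_mpoly_fun mmapB. Qed.

Lemma coord_mpoly_monoid : monoid_morphism coord_mpoly_fun.
Proof.
have [M1 M2] : multiplicative coord_mpoly_fun; last by split.
by apply: commr_mmap_is_multiplicative => *; apply: coord_ratfun_comm.
Qed.

(** B[x] -> B (x) K(x), a localization at the nonzero elements of K[x]. *)
Definition coord_mpoly : {rmorphism T -> S} :=
  HB.pack (coord_mpoly_fun : T -> S)
    (GRing.isZmodMorphism.Build T S (coord_mpoly_fun : T -> S) coord_mpoly_zmod)
    (GRing.isMonoidMorphism.Build T S (coord_mpoly_fun : T -> S) coord_mpoly_monoid).

End GlobalSections.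

(** * The fibres of the rank module *)

Lemma residue_map_eq0 (A : comNzRingType) (p : prime_idealr A) (a : A) :
  (residue_map p a == 0) = p a.
Proof. by rewrite /= tofrac_eq0 pq_pi_eq0. Qed.

Lemma residue_map_scalar (K : fieldType) (B : comAlgType K) (eps : {rmorphism B -> K})
    (q : prime_idealr B) (b : B) :
    algebra_map eps -> (forall b, eps b = 0 <-> q b) ->
  residue_map q (eps b)%:A = residue_map q b.
Proof.
move=> epsK eps_q; apply/eqP; rewrite -subr_eq0 -rmorphB residue_map_eq0.
by apply/eps_q; rewrite rmorphB epsK subrr.
Qed.

Lemma pure0 (T S : pzRingType) (g : {rmorphism T -> S}) (N : lmodType T) (s : S) :
  pure g s (0 : N) = 0.
Proof. by apply: (addIr (pure g s (0 : N))); rewrite -pureDr addr0 add0r. Qed.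

Section BaseChangeAction.
Variables (K E T R : pzRingType) (S : comPzRingType).
Variables (f : {rmorphism K -> E}) (h : {rmorphism K -> T}).
Variables (g : {rmorphism T -> S}).
Variables (u : {rmorphism E -> R}) (v : {rmorphism T -> R}).
Hypothesis uv_comm : forall e t, GRing.comm (u e) (v t).
Hypothesis uv_base : forall k, u (f k) = v (h k).
Variable M : lmodType R.

Lemma base_change_tensl e s (m : restr v M) :
  tensl f (g \o h) e *: (pure g s m : base_change g uv_comm uv_base M) =
  pure g s (u e *: (m : M) : restr v M).
Proof.
have actE := pres_actE (bc_genD uv_comm (M := M) (g := g))
  (bc_gen_rel uv_comm uv_base (M := M) (g := g)).
rewrite -[LHS]/(pres_act _ _ _) /tensl /pres_gen actE /=.
exact: (bc_left_pure g uv_comm).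
Qed.

Lemma base_change_tensr s (a : base_change g uv_comm uv_base M) :
  tensr f (g \o h) s *: a = (s *: (a : tensor g (restr v M)) : tensor g (restr v M)).
Proof.
have actE := pres_actE (bc_genD uv_comm (M := M) (g := g))
  (bc_gen_rel uv_comm uv_base (M := M) (g := g)).
by rewrite -[LHS]/(pres_act _ _ _) /tensr /pres_gen actE.
Qed.
End BaseChangeAction.

Section CoordinateRing.
Variables (K : fieldType) (n : nat) (B : comAlgType K).
Local Notation Kx := {mpoly K[n]}.
Local Notation T := {mpoly B[n]}.
Local Notation L := (ratfun K n).
Local Notation S := (coord_ratfun n B).
Local Notation sl := (tensl (in_alg B) (poly_ratfun K n \o @mpolyC n K)).
Local Notation sr := (tensr (in_alg B) (poly_ratfun K n \o @mpolyC n K)).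

Variable eps0 : {rmorphism B -> K}.
Hypothesis eps0K : algebra_map eps0.
Local Notation tau := (coord_mpoly n eps0K).

Lemma coord_mpolyC b : tau b%:MP = sl b.
Proof. by rewrite -[LHS]/(coord_mpoly_fun eps0K b%:MP) /coord_mpoly_fun mmapC. Qed.

Lemma coord_mpolyX i : tau 'X_i = sr (poly_ratfun K n 'X_i).
Proof.
rewrite -[LHS]/(coord_mpoly_fun eps0K 'X_i) /coord_mpoly_fun mmapX mmap1U.
by [].
Qed.

Lemma coord_mpoly_base e : tau (base_poly n B e) = sr (poly_ratfun K n e).
Proof.
elim/mpoly_ring_ind: e => [c|i|p q pE qE|p q pE qE].
- by rewrite [base_poly _ _ _]map_mpolyC coord_mpolyC tensl_base.
- by rewrite [base_poly _ _ _]map_mpolyX coord_mpolyX.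
- by rewrite !rmorphD pE qE.
- by rewrite !rmorphM pE qE.
Qed.

(** By induction on the expression of the element in the generators. *)
Lemma coord_ratfun_den (a : S) :
  exists2 e : Kx, e != 0 & exists t : T, sr (poly_ratfun K n e) * a = tau t.
Proof.
pose good (a : S) e := exists t : T, sr (poly_ratfun K n e) * a = tau t.
have goodM b e f : good b e -> good b (f * e).
  by move=> [t tE]; exists (base_poly n B f * t); rewrite !rmorphM -mulrA tE coord_mpoly_base.
rewrite -[a]pres_repK; elim: (pres_rep a) => [[b|s]|||u [e e0 eu]|u [e e0 eu] v [f f0 fv]|
    u [e e0 [p pE]] v [f f0 [q qE]]].
- exists 1; first exact: oner_neq0.
  by exists b%:MP; rewrite !rmorph1 mul1r coord_mpolyC.
- have [e [c [e0 ec]]] := fraction_den s; exists e => //; exists (base_poly n B c).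
  by rewrite coord_mpoly_base -[pres_cls _ _]/(sr s) -rmorphM ec.
- exists 1; first exact: oner_neq0.
  by exists 0; rewrite pres_clsE mulr0 rmorph0.
- exists 1; first exact: oner_neq0.
  by exists 1; rewrite pres_clsE mulr1 !rmorph1.
- by exists e => //; have [t tE] := eu; exists (- t); rewrite pres_clsE mulrN tE rmorphN.
- exists (e * f); first exact: mulf_neq0.
  have [t tE] := goodM _ _ e fv; have [t' tE'] := goodM _ _ f eu.
  by exists (t' + t); rewrite pres_clsE mulrDr tE [e * f]mulrC tE' rmorphD.
exists (e * f); first exact: mulf_neq0.
exists (p * q); rewrite pres_clsE !rmorphM -pE -qE -!mulrA; congr (_ * _).
by rewrite !mulrA; congr (_ * _); apply: coord_ratfun_comm.
Qed.

End CoordinateRing.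

Section FibreAtPoint.
Variables (K : fieldType) (n : nat) (B : comAlgType K) (M : lmodType (weylA n B)).
Local Notation Kx := {mpoly K[n]}.
Local Notation T := {mpoly B[n]}.
Local Notation L := (ratfun K n).
Local Notation ML := (restr (@poly_weylA K n B) M).
Local Notation MB := (restr (tensr (@wconst K n) (in_alg B)) M).
Local Notation prat := (poly_ratfun K n).
Local Notation wl := (tensl (@wconst K n) (in_alg B)).
Local Notation wr := (tensr (@wconst K n) (in_alg B)).
Local Notation sl := (tensl (in_alg B) (prat \o @mpolyC n K)).
Local Notation sr := (tensr (in_alg B) (prat \o @mpolyC n K)).

Variables (eps0 : {rmorphism B -> K}) (eps0K : algebra_map eps0).
Local Notation tau := (coord_mpoly n eps0K).
Local Notation N := (restr tau (rank_module M)).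

Variables (q : prime_idealr B) (eps : {rmorphism B -> K}).
Hypothesis epsK : algebra_map eps.
Hypothesis eps_q : forall b, eps b = 0 <-> q b.
Hypothesis res_surj : forall k, exists b, residue_map q b = k.

Local Notation res := (residue_map q).
Local Notation Fq := (fiber M q).
Local Notation FK :=
  (restr (@poly_weyl K n) (restr (tensl (@wconst K n) (res \o in_alg B)) Fq)).

Definition fibre_space : lmodType L := tensor prat FK.

Definition pureN (s : L) (m : M) : N := pure prat s (m : ML).
Definition pureF (k : residue_field q) (m : M) : FK := pure res k (m : MB).

Lemma pureN_sl b s m : sl b *: (pureN s m : rank_module M) = pureN s (wr b *: m).
Proof. exact: base_change_tensl. Qed.

Lemma pureN_sr l s m : sr l *: (pureN s m : rank_module M) = pureN (l * s) m.
Proof.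
rewrite [LHS]base_change_tensr; exact: tensor_scale_pure.
Qed.

Lemma pureF_res k b m : pureF (k * res b) m = pureF k (wr b *: m).
Proof. exact: (pureZ res). Qed.

Lemma pureF_poly (p : Kx) k m : p *: pureF k m = pureF k (poly_weylA n B p *: m).
Proof.
rewrite -[LHS]/(tensl (@wconst K n) (res \o in_alg B) (poly_weyl p) *: (pure res k (m : MB) : Fq)).
exact: base_change_tensl.
Qed.

(** s (x) m goes to s (x) (1 (x) m). *)
Definition to_fibre : N -> fibre_space :=
  tensor_lift (fun s (m : ML) => pure prat s (pureF 1 m)).

Lemma to_fibre_aux1 s s' (m : ML) :
  pure prat (s + s') (pureF 1 m) = pure prat s (pureF 1 m) + pure prat s' (pureF 1 m).
Proof. exact: pureDl. Qed.

Lemma to_fibre_aux2 s (m m' : ML) :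
  pure prat s (pureF 1 (m + m')) = pure prat s (pureF 1 m) + pure prat s (pureF 1 m').
Proof. rewrite -pureDr; congr pure; exact: (pureDr res). Qed.

Lemma to_fibre_aux3 s p (m : ML) :
  pure prat (s * prat p) (pureF 1 m) = pure prat s (pureF 1 (p *: m)).
Proof. by rewrite pureZ pureF_poly. Qed.

Lemma to_fibreD : {morph to_fibre : u v / u + v}.
Proof. exact: (tensor_liftD to_fibre_aux1 to_fibre_aux2 to_fibre_aux3). Qed.

Lemma to_fibre_pure s m : to_fibre (pureN s m) = pure prat s (pureF 1 m).
Proof. exact: (tensor_lift_pure to_fibre_aux1 to_fibre_aux2 to_fibre_aux3). Qed.

Lemma to_fibreN : {morph to_fibre : u / - u}.
Proof. exact: (tensor_liftN to_fibre_aux1 to_fibre_aux2 to_fibre_aux3). Qed.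

Lemma to_fibre0 : to_fibre 0 = 0.
Proof. exact: (tensor_lift0 to_fibre_aux1 to_fibre_aux2 to_fibre_aux3). Qed.

Lemma pureF_surj (a : FK) : exists m, a = pureF 1 m.
Proof.
elim/(@tensor_ind _ _ res MB): a => [k m||_ [m ->]|_ _ [m ->] [m' ->]].
- have [b <-] := res_surj k; exists (wr b *: m).
  by rewrite -pureF_res mul1r.
- by exists 0; rewrite [RHS]pure0.
- exists (- m); apply/eqP; rewrite eq_sym -subr_eq0 opprK -(pureDr res) addNr.
  by rewrite pure0.
- by exists (m + m'); rewrite -(pureDr res).
Qed.

Lemma to_fibre_surj v : exists u, to_fibre u = v.
Proof.
elim/(@tensor_ind _ _ prat FK): v => [s a||_ [u <-]|_ _ [u <-] [u' <-]].
- by have [m ->] := pureF_surj a; exists (pureN s m); apply: to_fibre_pure.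
- by exists 0; apply: to_fibre0.
- by exists (- u); apply: to_fibreN.
- by exists (u + u'); apply: to_fibreD.
Qed.


Lemma to_fibre_sr l u : to_fibre (sr l *: (u : rank_module M)) = l *: to_fibre u.
Proof.
move: u; apply: (@tensor_additive_eq _ _ prat ML) => [u v|u v|s m].
- by rewrite [X in to_fibre X](@scalerDr _ (rank_module M)) to_fibreD.
- by rewrite to_fibreD scalerDr.
rewrite -[pure _ _ _]/(pureN s m) pureN_sr !to_fibre_pure.
by rewrite -[RHS]/(tensor_scale _ _) tensor_scale_pure.
Qed.

Lemma to_fibre_sl b u :
  to_fibre (sl b *: (u : rank_module M)) = prat (eps b)%:MP *: to_fibre u.
Proof.
move: u; apply: (@tensor_additive_eq _ _ prat ML) => [u v|u v|s m].
- by rewrite [X in to_fibre X](@scalerDr _ (rank_module M)) to_fibreD.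
- by rewrite to_fibreD scalerDr.
rewrite -[pure _ _ _]/(pureN s m) pureN_sl !to_fibre_pure.
rewrite -[RHS]/(tensor_scale _ _) tensor_scale_pure mulrC pureZ pureF_poly.
congr pure; rewrite -poly_weylA_base.
by rewrite -!pureF_res !mul1r (residue_map_scalar b epsK eps_q).
Qed.

Lemma to_fibre_equiv (t : T) (u : N) :
  to_fibre (t *: u) = tofrac (ev n eps t) *: to_fibre u.
Proof.
elim/mpoly_ring_ind: t u => [b|i|p1 p2 p1E p2E|p1 p2 p1E p2E] u.
- by rewrite -[_ *: u]/(tau b%:MP *: (u : rank_module M)) coord_mpolyC to_fibre_sl evC.
- rewrite -[_ *: u]/(tau 'X_i *: (u : rank_module M)) coord_mpolyX to_fibre_sr.
  by rewrite [ev _ _ _]map_mpolyX.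
- by rewrite scalerDl to_fibreD p1E p2E rmorphD tofracD scalerDl.
- by rewrite -scalerA p1E p2E rmorphM tofracM scalerA.
Qed.

(** The submodule ker(eps) N. *)
Definition point_multiple (u : N) : Prop :=
  exists (k : nat) (z : 'I_k -> B) (w : 'I_k -> N),
    (forall i, eps (z i) = 0) /\ u = \sum_i (z i)%:MP *: w i.

Definition point_multipleb (u : N) : bool := `[< point_multiple u >].

Lemma point_multiple_zmod : zmod_closed point_multipleb.
Proof.
split=> [|u v /asboolP [k [z [w [z0 ->]]]] /asboolP [l [z' [w' [z'0 ->]]]]]; apply/asboolP.
  by exists 0%N, (fun=> 0), (fun=> 0); rewrite big_ord0; split=> // - [].
exists (k + l)%N, (fun i => match split i with inl j => z j | inr j => z' j end),
  (fun i => match split i with inl j => w j | inr j => - w' j end); split=> [i|].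
  by case: (split i).
rewrite big_split_ord /= -sumrN; congr (_ + _); apply: eq_bigr => i _.
  by rewrite -[lshift l i]/(unsplit (inl i)) unsplitK.
by rewrite -[rshift k i]/(unsplit (inr i)) unsplitK scalerN.
Qed.

Definition point_zmod : zmodClosed N :=
  HB.pack point_multipleb (GRing.isZmodClosed.Build N point_multipleb point_multiple_zmod).

Definition Nq : zmodType := {ideal_quot point_zmod}.
Definition piq (u : N) : Nq := \pi_{ideal_quot point_zmod}%qT u.

Lemma piqD : {morph piq : u v / u + v}.
Proof. exact: (raddfD (\pi_{ideal_quot point_zmod}%qT)). Qed.

Lemma piq_eq u v : point_multiple (u - v) -> piq u = piq v.
Proof.
move=> uv; apply/eqP; rewrite /piq -Quotient.idealrBE.
exact/asboolP.
Qed.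

Lemma piq_eq0 u : piq u = 0 -> point_multiple u.
Proof.
rewrite -[0](raddf0 (\pi_{ideal_quot point_zmod}%qT)) => /eqP.
by rewrite -Quotient.idealrBE subr0 => /asboolP.
Qed.

Section Retraction.
Variable psi : {rmorphism residue_field q -> K}.
Hypothesis psi_res : forall b, psi (res b) = eps b.

Definition coeffF (k : residue_field q) : L := prat (psi k)%:MP.

Lemma pureN_res s b m :
  point_multiple (pureN (s * prat (eps b)%:MP) m - pureN s (wr b *: m)).
Proof.
exists 1%N, (fun=> (eps b)%:A - b), (fun=> pureN s m).
rewrite big_ord_recl big_ord0 addr0; split=> [_|]; first by rewrite rmorphB epsK subrr.
rewrite -[RHS]/(tau _ *: (pureN s m : rank_module M)) coord_mpolyC rmorphB scalerBl.
rewrite !pureN_sl; congr (_ - _).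
have -> : wr (eps b)%:A = poly_weylA n B (eps b)%:MP by exact: poly_weylA_base.
exact: (pureZ prat).
Qed.

(** The map from the fibre back to N / ker(eps) N, built by the universal
    properties of the two tensor products in turn; by [to_fibreK] it bounds the
    kernel of [to_fibre]. *)
Definition from_inner (s : L) : FK -> Nq :=
  tensor_lift (fun k (m : MB) => piq (pureN (s * coeffF k) m)).

Lemma from_inner_aux1 s k k' (m : MB) : piq (pureN (s * coeffF (k + k')) m) =
  piq (pureN (s * coeffF k) m) + piq (pureN (s * coeffF k') m).
Proof.
rewrite -piqD; congr piq; rewrite -[RHS](pureDl prat); congr pure.
by rewrite -mulrDr /coeffF rmorphD mpolyCD rmorphD.
Qed.

Lemma from_inner_aux2 s k (m m' : MB) : piq (pureN (s * coeffF k) (m + m')) =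
  piq (pureN (s * coeffF k) m) + piq (pureN (s * coeffF k) m').
Proof. by rewrite -piqD; congr piq; apply: (pureDr prat). Qed.

Lemma from_inner_aux3 s k b (m : MB) : piq (pureN (s * coeffF (k * res b)) m) =
  piq (pureN (s * coeffF k) (b *: m)).
Proof.
apply: piq_eq; rewrite /coeffF rmorphM psi_res mpolyCM rmorphM mulrA.
exact: pureN_res.
Qed.

Lemma from_innerD s : {morph from_inner s : a b / a + b}.
Proof.
exact: (tensor_liftD (@from_inner_aux1 s) (@from_inner_aux2 s) (@from_inner_aux3 s)).
Qed.

Lemma from_inner_pure s k m : from_inner s (pureF k m) = piq (pureN (s * coeffF k) m).
Proof.
exact: (tensor_lift_pure (@from_inner_aux1 s) (@from_inner_aux2 s) (@from_inner_aux3 s)).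
Qed.

Definition from_fibre : fibre_space -> Nq :=
  tensor_lift (fun s (a : FK) => from_inner s a).

Lemma from_fibre_aux1 s s' (a : FK) :
  from_inner (s + s') a = from_inner s a + from_inner s' a.
Proof.
move: a; apply: (@tensor_additive_eq _ _ res MB) => [a b|a b|k m].
- exact: from_innerD.
- by rewrite !from_innerD addrACA.
rewrite -[pure _ _ _]/(pureF k m) !from_inner_pure -piqD; congr piq.
by rewrite -[RHS](pureDl prat) -mulrDl.
Qed.

Lemma from_fibre_aux3 s p (a : FK) : from_inner (s * prat p) a = from_inner s (p *: a).
Proof.
move: a; apply: (@tensor_additive_eq _ _ res MB) => [a b|a b|k m].
- exact: from_innerD.
- by rewrite -from_innerD -(@scalerDr _ FK).
rewrite -[pure _ _ _]/(pureF k m) pureF_poly !from_inner_pure; congr piq.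
by rewrite mulrAC; apply: (pureZ prat).
Qed.

Lemma to_fibreK u : from_fibre (to_fibre u) = piq u.
Proof.
have aux2 s : {morph from_inner s : a b / a + b} := @from_innerD s.
have liftD := tensor_liftD from_fibre_aux1 aux2 from_fibre_aux3.
move: u; apply: (@tensor_additive_eq _ _ prat ML) => [u v|u v|s m].
- by rewrite to_fibreD; apply: liftD.
- exact: piqD.
rewrite -[pure _ _ _]/(pureN s m) to_fibre_pure /from_fibre.
rewrite (tensor_lift_pure from_fibre_aux1 aux2 from_fibre_aux3) from_inner_pure.
by rewrite /coeffF !rmorph1 mulr1.
Qed.
End Retraction.

(** The fibre of the rank module at a rational point: the double base change
    K(x) (x) (kappa (x) M) is the quotient of M(x) by the ideal of the point. *)
Lemma to_fibre_model : fibre_model eps to_fibre.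
Proof.
have ker0 b : res b = 0 -> eps b = 0.
  by move/eqP; rewrite residue_map_eq0 => /eps_q.
have [psi psiE] := rmorph_factor res_surj ker0.
split; [exact: to_fibreD | exact: to_fibre_surj | exact: to_fibre_equiv |] => u u0.
apply: piq_eq0; rewrite -(to_fibreK psiE) u0.
by rewrite -to_fibre0 (to_fibreK psiE) /piq (raddf0 (\pi_{ideal_quot point_zmod}%qT)).
Qed.
End FibreAtPoint.

(** * Rational points and the theorem *)

Section RationalPoints.
Variables (K : fieldType) (B : comAlgType K).

Lemma rational_point_eval (q : prime_idealr B) : rational_point q ->
  exists eps : {rmorphism B -> K}, [/\ algebra_map eps, forall b, eps b = 0 <-> q b &
    forall k, exists b, residue_map q b = k].
Proof.
move=> [_ [g fK gK]].
pose f : {rmorphism K -> residue_field q} := residue_map q \o in_alg B.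
have f_surj k : exists c, f c = k by exists (g k); apply: gK.
have ker0 c : f c = 0 -> idfun c = 0 by move/eqP; rewrite fmorph_eq0 => /eqP.
have [psi psiE] := rmorph_factor f_surj ker0.
exists (psi \o residue_map q); split=> [c|b|k].
- exact: psiE.
- rewrite -residue_map_eq0 -[X in X = 0]/(psi (residue_map q b)).
  by split=> [/eqP|/eqP ->]; [rewrite fmorph_eq0 | apply: rmorph0].
- by have [c <-] := f_surj k; exists c%:A.
Qed.

(** Every denominator of the fraction field of B / ker(eps) is the class of some a
    with eps(a) nonzero, hence equal to a nonzero scalar: the residue field
    is K. *)
Lemma eval_rational_point (eps : {rmorphism B -> K}) :
  algebra_map eps -> rational_point (rker eps : prime_idealr B).
Proof.
move=> epsK; set q : prime_idealr B := rker eps.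
have eps_q b : eps b = 0 <-> q b by split=> /eqP.
have qK c : q c%:A -> c = 0 by move/eqP; rewrite epsK.
split.
  exists (fun a => eps a = 0) => p; split=> [npq|[a a0 npa] pq]; last first.
    by move/eqP: a0; rewrite -[eps a == 0]/(q a) -pq (negPf npa).
  apply: contrapT => nex; apply: npq => a.
  have sub b : q b -> p b.
    by move=> /eqP b0; apply/negPn/negP => npb; apply: nex; exists b.
  apply/idP/idP; last exact: sub.
  move=> pa; apply/negPn/negP => nqa.
  have pc : p (eps a)%:A.
    have pd : p (a - (eps a)%:A) by apply/sub/eps_q; rewrite rmorphB epsK subrr.
    by have := rpredB (pa : a \in p) (pd : _ \in p); rewrite opprB addrC subrK.
  have := idealMr (((eps a)^-1)%:A : B) (pc : _ \in p).
  have -> : ((eps a)^-1)%:A * (eps a)%:A = 1 :> B.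
    by rewrite -(rmorphM (in_alg B)) mulVf ?rmorph1.
  by rewrite idealr1.
have rE b : residue_map q (eps b)%:A = residue_map q b := residue_map_scalar b epsK eps_q.
have r_surj k : exists b, residue_map q b = k.
  have [e [c [e0 ec]]] := fraction_den k.
  have [a aE] := pq_pi_surj e; have [b bE] := pq_pi_surj c.
  have epsa0 : eps a != 0.
    by apply: contraNneq e0 => /eps_q; rewrite -pq_pi_eq0 aE.
  exists (b * ((eps a)^-1)%:A); rewrite rmorphM.
  have ra : residue_map q a != 0 by rewrite residue_map_eq0.
  have kE : residue_map q a * k = residue_map q b by rewrite [residue_map q b]/= bE -ec -aE.
  apply: (mulfI ra); rewrite kE mulrCA -(rE a) -rmorphM -(rmorphM (in_alg B)).
  by rewrite divff // !rmorph1 mulr1.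
have ker0 b : residue_map q b = 0 -> eps b = 0.
  by move/eqP; rewrite residue_map_eq0 => /eps_q.
have [psi psiE] := rmorph_factor r_surj ker0.
exists psi => [c|k]; first by rewrite psiE epsK.
by have [b <-] := r_surj k; rewrite psiE rE.
Qed.

End RationalPoints.

Section RankModule.
Variables (K : fieldType) (n : nat) (B : comAlgType K) (M : lmodType (weylA n B)).
Variables (eps0 : {rmorphism B -> K}) (eps0K : algebra_map eps0).
Local Notation N := (restr (coord_mpoly n eps0K) (rank_module M)).
Local Notation Kx := {mpoly K[n]}.
Local Notation sr := (tensr (in_alg B) (poly_ratfun K n \o @mpolyC n K)).

Lemma base_polyE (e : Kx) (v : N) :
  base_poly n B e *: v = sr (poly_ratfun K n e) *: (v : rank_module M) :> rank_module M.
Proof. by rewrite -(coord_mpoly_base eps0K). Qed.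

Lemma rank_base_inj (e : Kx) (v : N) : e != 0 -> base_poly n B e *: v = 0 -> v = 0.
Proof.
move=> e0; rewrite base_polyE => ev0.
have e0' : poly_ratfun K n e != 0 by rewrite tofrac_eq0.
rewrite -[v](@scale1r _ (rank_module M)) -(rmorph1 sr) -(mulVf e0') rmorphM.
by rewrite -(@scalerA _ (rank_module M)) ev0 (@scaler0 _ (rank_module M)).
Qed.

Lemma rank_base_div (e : Kx) (v : N) : e != 0 -> exists u : N, base_poly n B e *: u = v.
Proof.
move=> e0; have e0' : poly_ratfun K n e != 0 by rewrite tofrac_eq0.
exists (sr (poly_ratfun K n e)^-1 *: (v : rank_module M)).
rewrite base_polyE (@scalerA _ (rank_module M)) -rmorphM mulfV // rmorph1.
exact: (@scale1r _ (rank_module M)).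
Qed.

Lemma rank_generators : finitely_generated (rank_module M) ->
  exists (k : nat) (g : 'I_k -> N),
    forall v, exists2 e : Kx, e != 0 & lincombs g (base_poly n B e *: v).
Proof.
move=> [k [m mP]]; exists k, m => v; have [a ->] := mP v.
have [i e f [t tE]|i|e e0 He] := @common_multiple Kx 'I_k
    (fun i e => exists t, sr (poly_ratfun K n e) * a i = coord_mpoly n eps0K t).
- by exists (base_poly n B f * t); rewrite !rmorphM -mulrA tE coord_mpoly_base.
- exact: coord_ratfun_den.
have [t tE] := choice He; exists e => //; exists t.
rewrite base_polyE scaler_sumr; apply: eq_bigr => i _.
by rewrite scalerA tE.
Qed.

Lemma rank_koszul d (y : 'I_d -> B) i :
  koszul_homology_neq0 y (rank_moduleA M) i <->
  koszul_homology_neq0 (fun j => (y j)%:MP : {mpoly B[n]}) N i.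
Proof.
apply: (@koszul_homology_transfer _ _ d y (@mpolyC n B) (rank_moduleA M) N id id) => //.
move=> a v; rewrite -[RHS]/(coord_mpoly n eps0K a%:MP *: (v : rank_module M)).
by rewrite coord_mpolyC.
Qed.

End RankModule.

(** The open sets needed are basic ones.  In one direction, t in B[x] does not
    vanish at any point where one of its coefficients does not; in the other,
    a point of an open set has a basic neighbourhood inside it. *)
Theorem rank_jumping_iff_koszul (K : closedFieldType) (n : nat) (B : comAlgType K)
    (M : lmodType (weylA n B)) (beta : prime_idealr B) (d : nat) (y : 'I_d -> B) :
    finitely_generated_algebra B -> reduced B -> finitely_generated (rank_module M) ->
    rational_point beta -> regular_sequence y ->
    (forall a : B, beta a <-> in_span y predT a) ->
  rank_jumping M beta <->
  exists i : nat, (0 < i)%N /\ koszul_homology_neq0 y (rank_moduleA M) i.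
Proof.
move=> B_fg B_red M_fg beta_rat y_reg y_beta.
have [eps0 [eps0K eps0_beta res0_surj]] := rational_point_eval beta_rat.
have y_ideal b : eps0 b = 0 <-> in_span y predT b.
  by split=> [/eps0_beta/y_beta //|/y_beta/eps0_beta].
pose N := restr (coord_mpoly n eps0K) (rank_module M).
have [k0 [g0 g0_gen]] := rank_generators eps0K M_fg.
have fm0 := to_fibre_model M eps0K eps0K eps0_beta res0_surj.
have noeT : noetherian_mod ({mpoly B[n]})^o.
  have [m [x x_gen]] := B_fg.
  apply: noetherian_mpoly; apply: (@noetherian_ring_image {mpoly K[m]} B (mmap (in_alg B) x)).
    by move=> b; have [p ->] := x_gen b; exists p.
  exact/noetherian_mpoly/noetherian_field.
have null (z : B) : (forall eps : {rmorphism B -> K}, algebra_map eps -> eps z = 0) -> z = 0.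
  by move=> /(nullstellensatz B_fg) [k]; apply: B_red.
have rank_ex q : rational_point q -> exists s, fiber_rank_eq M q s.
  move=> /rational_point_eval [eps [epsK eps_q r_surj]].
  have fm := to_fibre_model M eps0K epsK eps_q r_surj.
  exact: basis_exists (fibre_generators g0_gen epsK fm).
have [r rank_beta] := rank_ex beta beta_rat.
have /basisP [b [ib sb]] := rank_beta.
have /choice [g gE] := fun i => fm_surj fm0 (b i).
have gb : to_fibre (eps0K := eps0K) beta \o g = b by apply: funext => i; apply: gE.
rewrite -gb in ib sb.
split=> [[_ [r' rank' jump]]|[i [i_gt0 Hi]]].
  have rr' : r' = r.
    have /basisP [b' [ib' sb']] := rank'.
    by apply/eqP; rewrite eqn_leq (indep_le sb ib') (indep_le sb' ib).
  apply: contrapT => H; have [|t t0 t_indep] :=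
      indep_spread g0_gen eps0K y_ideal fm0 sb noeT ib.
    by move=> /(rank_koszul M eps0K) H1; apply: H; exists 1%N.
  have [m tm] : exists m, eps0 t@_m != 0.
    apply: contrapT => nm; move/eqP: t0; apply; apply/mpolyP => m.
    rewrite mcoeff_map_mpoly mcoeff0; apply/eqP/negPn/negP => tm.
    by apply: nm; exists m.
  pose U (q : prime_idealr B) : Prop := ~~ q t@_m.
  have [||r0 [[q [Uq q_rat rank_q]] _]] := jump U.
  - exists (eq t@_m) => q; split=> [Uq|[_ <-] //]; by exists t@_m.
  - by apply/negP => /eps0_beta/eqP; rewrite (negPf tm).
  have [eps [epsK eps_q r_surj]] := rational_point_eval q_rat.
  have fm := to_fibre_model M eps0K epsK eps_q r_surj.
  have tq : ev n eps t != 0.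
    apply: contraNneq Uq => /(congr1 (mcoeff m)).
    by rewrite mcoeff_map_mpoly mcoeff0 => /eps_q.
  have /basisP [c [ic sc]] := rank_q.
  by rewrite rr' ltnNge (indep_le sc (t_indep _ _ _ epsK fm tq)).
split=> //; exists r => // U [I UI] Ubeta.
pose attained s := `[< exists q, [/\ U q, rational_point q & fiber_rank_eq M q s] >].
have ex_att : exists s, attained s by exists r; apply/asboolP; exists beta.
case: (ex_minnP ex_att) => r0 /asboolP att0 r0_min; exists r0.
  by split=> // q s Uq q_rat rank_q; apply: r0_min; apply/asboolP; exists q.
rewrite ltnNge; apply/negP => le_r; have [a Ia nbeta_a] := (UI beta).1 Ubeta.
case: i i_gt0 Hi => // i _ /(rank_koszul M eps0K).
apply: (koszul_vanishing g0_gen (@rank_base_inj _ _ _ M _ eps0K) (@rank_base_div _ _ _ M _ eps0K)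
  eps0K y_ideal fm0 sb (b := a)) => //.
  by apply/eqP => /eps0_beta; rewrite (negPf nbeta_a).
move=> eps epsK eps_a.
pose q : prime_idealr B := rker eps.
have q_rat : rational_point q := eval_rational_point epsK.
have [_ [_ _ r_surj]] := rational_point_eval q_rat.
have eps_q c : eps c = 0 <-> q c by split=> /eqP.
have fm := to_fibre_model M eps0K epsK eps_q r_surj.
exists (fibre_space M q), (to_fibre (eps0K := eps0K) q); split=> // sg.
have [s rank_q] := rank_ex q q_rat; have /basisP [c [ic sc]] := rank_q.
apply: (spans_min_indep sg ic sc); apply: (leq_trans le_r); apply: r0_min.
apply/asboolP; exists q; split=> //; apply/UI; exists a => //.
Qed.

Theorem corollary3p3 (R : realType) (n : nat) (B : comAlgType R[i])
    (B_fg : finitely_generated_algebra B) (B_reduced : reduced B)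
    (M : lmodType (weylA n B)) (M_family : holonomic_family M)
    (beta : prime_idealr B) (beta_rational : rational_point beta)
    (d : nat) (y : 'I_d -> B) (y_regular : regular_sequence y)
    (y_beta : forall a : B, beta a <-> in_span y predT a) :
  rank_jumping M beta <->
  exists i : nat, (0 < i)%N /\ koszul_homology_neq0 y (rank_moduleA M) i.
Proof.
have [_ _ M_fg] := M_family.
exact: (@rank_jumping_iff_koszul R[i] n B M beta d y).
Qed.
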